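(* Let $\Gamma$ be a $*$-semigroup that acts on the nonempty set $X$, and let $\mathbf{k}\colon X\times X\to Z$ be a $Z$-valued kernel for some admissible space $Z$. The following assertions are equivalent: (1) $\mathbf{k}$ satisfies the following conditions: (a) $\mathbf{k}$ is weakly positive semidefinite; (b) $\mathbf{k}$ is invariant under the action of $\Gamma$ on $X$, that is, $\mathbf{k}(y,\xi\cdot x)=\mathbf{k}(\xi^*\cdot y,x)$ for all $x,y\in X$ and all $\xi\in\Gamma$; (c) for any $\alpha\in\Gamma$ there exists $c(\alpha)\ge 0$ such that $$\sum_{j,k=1}^n t_j\overline{t_k}\,\mathbf{k}(\alpha\cdot x_k,\alpha\cdot x_j)\le c(\alpha)^2\sum_{j,k=1}^n t_j\overline{t_k}\,\mathbf{k}(x_k,x_j)$$ for all $n\in\mathbb{N}$, all $x_1,\dots,x_n\in X$, and all $t_1,\dots,t_n\in\mathbb{C}$. (2) $\mathbf{k}$ has a boundedly adjointable invariant weak VH-space linearisation $(\mathcal{K};\pi;V)$. (3) $\mathbf{k}$ admits a weak $Z$-reproducing kernel VH-space $\mathcal{R}$ and there exists a $*$-representation $\rho\colon\Gamma\to\mathcal{B}^*(\mathcal{R})$ such that $\rho(\xi)\mathbf{k}_x=\mathbf{k}_{\xi\cdot x}$ for all $\xi\in\Gamma$, $x\in X$. Moreover, in case any of the assertions (1), (2), or (3) holds, then a topologically minimal boundedly adjointable invariant weak VH-space linearisation can be constructed (i.e. exists), and a topologically minimal weak $Z$-reproducing kernel VH-space $\mathcal{R}$ as in assertion (3) can be constructed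 (i.e. exists) as well.
   Context: Ordered $*$-space: a complex vector space $Z$ with (a1) an involution $z\mapsto z^*$ that is conjugate linear and satisfies $(z^* )^*=z$; (a2) a convex cone $Z_+\subseteq Z$ ($sx+ty\in Z_+$ for all real $s,t\ge 0$ and $x,y\in Z_+$) that is strict ($Z_+\cap -Z_+=\{0\}$) and consists of selfadjoint elements only. One writes $z_1\ge z_2$ if $z_1-z_2\in Z_+$. $Z$ is topologically ordered if moreover (a3) $Z$ is a Hausdorff locally convex space; (a4) $Z_+$ is closed; (a5) the topology has a base linearly generated by a family of neighbourhoods of $0$ that are absolutely convex and solid ($x\in N$ and $0\le y\le x$ imply $y\in N$); equivalently, the topology is defined by a family of seminorms $p$ that are increasing ($0\le x\le y$ implies $p(x)\le p(y)$). $Z$ is admissible if in addition (a6) its topology is complete. VE-space over $Z$: a complex vector space $\mathcal{E}$ with a $Z$-valued inner product (gramian) $[\cdot,\cdot]_{\mathcal{E}}\colon\mathcal{E}\times\mathcal{E}\to Z$ such that $[x,x]\ge 0$ with $[x,x]=0$ iff $x=0$; $[x,y]=[y,x]^*$; and $[\cdot,\cdot]$ is linear in the second variable. If $Z$ is topologically ordered, $\mathcal{E}$ carries the Hausdorff locally convex topology defined by the seminorms $h\mapsto p([h,h])^{1/2}$, with $p$ running over a family of increasing seminorms defining the topology of $Z$. If $Z$ and $\mathcal{E}$ are both complete, $\mathcal{E}$ is a VH-space over $Z$. A linear operator $T\colon\mathcal{K}\to\mathcal{K}$ is bounded if there is $C\ge0$ with $[Te,Te]\le C^2[e,e]$ for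 all $e$; it is adjointable if there is a linear operator $T^*\colon\mathcal{K}\to\mathcal{K}$ with $[Te,f]=[e,T^*f]$ for all $e,f$. $\mathcal{B}^*(\mathcal{K})$ is the $*$-algebra of all bounded adjointable linear operators on $\mathcal{K}$. A $*$-semigroup is a semigroup $\Gamma$ with an involution $*$ such that $(\xi\eta)^*=\eta^*\xi^*$ and $(\xi^* )^*=\xi$ (no unit is assumed). An action of $\Gamma$ on $X$ is a map $(\xi,x)\mapsto\xi\cdot x\in X$ with $\alpha\cdot(\beta\cdot x)=(\alpha\beta)\cdot x$. A $*$-representation is a multiplicative map $\pi$ with $\pi(\xi^* )=\pi(\xi)^*$. Kernels: a $Z$-valued kernel on $X$ is a map $\mathbf{k}\colon X\times X\to Z$; it is Hermitian if $\mathbf{k}(x,y)=\mathbf{k}(y,x)^*$ for all $x,y$. It is weakly positive semidefinite if for all $n\in\mathbb{N}$, $x_1,\dots,x_n\in X$, $t_1,\dots,t_n\in\mathbb{C}$ one has $\sum_{j,k=1}^n\overline{t_k}t_j\mathbf{k}(x_k,x_j)\ge 0$. A boundedly adjointable invariant weak VH-space linearisation of $\mathbf{k}$ and the action of $\Gamma$ on $X$ is a triple $(\mathcal{K};\pi;V)$ where $\mathcal{K}$ is a VH-space over $Z$, $V\colon X\to\mathcal{K}$ is a map with $\mathbf{k}(x,y)=[V(x),V(y)]_{\mathcal{K}}$ for all $x,y\in X$, $\pi\colon\Gamma\to\mathcal{B}^*(\mathcal{K})$ is a $*$-representation, and $V(\xi\cdot x)=\pi(\xi)V(x)$ for all $x\in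 X$, $\xi\in\Gamma$. It is topologically minimal if the linear span of $V(X)$ is dense in $\mathcal{K}$. A weak $Z$-reproducing kernel VH-space on $X$ with kernel $\mathbf{k}$ ($\mathbf{k}$ Hermitian) is a VH-space $\mathcal{R}$ over $Z$ such that: $\mathcal{R}$ is a vector subspace of $Z^X$ (the space of all functions $X\to Z$); for all $x\in X$ the function $\mathbf{k}_x=\mathbf{k}(\cdot,x)$ belongs to $\mathcal{R}$; and $f(x)=[\mathbf{k}_x,f]_{\mathcal{R}}$ for all $f\in\mathcal{R}$, $x\in X$. ''$\mathbf{k}$ admits'' such a space means one exists with kernel $\mathbf{k}$. It is topologically minimal if the linear span of $\{\mathbf{k}_x\mid x\in X\}$ is dense in $\mathcal{R}$. *)

(* Defs.v *)
From HB Require Import structures.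
From mathcomp Require Import all_boot all_order all_algebra.
From mathcomp Require Import all_classical all_reals all_analysis.
From mathcomp Require Import complex.

Set Implicit Arguments.
Unset Strict Implicit.
Unset Printing Implicit Defensive.

Import Order.TTheory GRing.Theory Num.Theory.
Import numFieldTopology.Exports numFieldNormedType.Exports.

Local Open Scope classical_set_scope.
Local Open Scope complex_scope.
Local Open Scope ring_scope.

HB.mixin Record Lmodule_isOrderedStar (R : realType) Z
    & GRing.Lmodule R[i] Z := {
  zstar : Z -> Z ;
  zpos : set Z ;
  zstar_conjlinear : forall (a : R[i]) (x y : Z),
    zstar (a *: x + y) = a^* *: zstar x + zstar y ;
  zstarK : forall z, zstar (zstar z) = z ;
  zpos_cone : forall (s t : R) (x y : Z), 0 <= s -> 0 <= t ->
    zpos x -> zpos y -> zpos (s%:C *: x + t%:C *: y) ;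
  zpos_strict : zpos `&` [set z | zpos (- z)] = [set 0] ;
  zpos_selfadjoint : forall z, zpos z -> zstar z = z
}.

#[short(type="orderedStarType")]
HB.structure Definition OrderedStar (R : realType) :=
  {Z of GRing.Lmodule R[i] Z & Lmodule_isOrderedStar R Z}.

Definition zle (R : realType) (Z : orderedStarType R) (x y : Z) : Prop :=
  zpos (y - x).

Notation "x <=z y" := (zle x y) (at level 70, no associativity).

Definition absolutely_convex (R : realType) (V : lmodType R[i]) (N : set V) :=
  forall (a b : R[i]) (x y : V),
    `|a| + `|b| <= 1 -> N x -> N y -> N (a *: x + b *: y).

Definition solid (R : realType) (Z : orderedStarType R) (N : set Z) :=
  forall x y : Z, N x -> 0 <=z y -> y <=z x -> N y.

Definition seminorm (R : realType) (V : lmodType R[i]) (p : V -> R) :=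
  [/\ forall x, 0 <= p x,
      forall x y, p (x + y) <= p x + p y &
      forall (a : R[i]) x, (p (a *: x))%:C = `|a| * (p x)%:C].

Definition increasing (R : realType) (Z : orderedStarType R) (p : Z -> R) :=
  forall x y : Z, 0 <=z x -> x <=z y -> p x <= p y.

(* Completeness as a topological vector space.  It is stated with the
   neighbourhoods of 0 because [tvsType] only requires its uniformity to
   induce the topology, not to be translation invariant, so that the
   library's [cauchy] could be the wrong notion. *)
Definition tvs_cauchy (K : numFieldType) (E : tvsType K) (F : set_system E) :=
  forall U : set E, nbhs (0 : E) U ->
    exists2 A : set E, F A & forall x y, A x -> A y -> U (x - y).

Definition tvs_complete (K : numFieldType) (E : tvsType K) :=
  forall F : set_system E, ProperFilter F -> tvs_cauchy F ->
    exists x : E, F --> x.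

HB.mixin Record OrderedStar_isTopOrdered (R : realType) Z
    & Tvs R[i] Z & OrderedStar R Z := {
  z_hausdorff : hausdorff_space Z ;
  zpos_closed : closed (zpos : set Z) ;
  z_solid_base : forall U : set Z, nbhs (0 : Z) U ->
    exists N : set Z,
      [/\ nbhs (0 : Z) N, absolutely_convex N, solid N & N `<=` U]
}.

#[short(type="topOrderedType")]
HB.structure Definition TopOrdered (R : realType) :=
  {Z of Tvs R[i] Z & OrderedStar R Z & OrderedStar_isTopOrdered R Z}.

HB.mixin Record TopOrdered_isAdmissible (R : realType) Z & TopOrdered R Z := {
  z_complete : tvs_complete Z
}.

#[short(type="admissibleType")]
HB.structure Definition Admissible (R : realType) :=
  {Z of TopOrdered R Z & TopOrdered_isAdmissible R Z}.

HB.mixin Record Lmodule_isVE (R : realType) (Z : orderedStarType R) E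
    & GRing.Lmodule R[i] E := {
  gram : E -> E -> Z ;
  gram_ge0 : forall x, 0 <=z gram x x ;
  gram_eq0 : forall x, gram x x = 0 <-> x = 0 ;
  gram_herm : forall x y, gram x y = zstar (gram y x) ;
  gram_linear : forall x (a : R[i]) y z,
    gram x (a *: y + z) = a *: gram x y + gram x z
}.

#[short(type="veType")]
HB.structure Definition VE (R : realType) (Z : orderedStarType R) :=
  {E of GRing.Lmodule R[i] E & Lmodule_isVE R Z E}.

(* The continuous increasing seminorms form the largest family of increasing
   seminorms defining the topology of [Z]; any other such family induces the
   same topology on [E].  As this family is stable under maxima, single
   seminorms suffice to describe the neighbourhoods of 0. *)
HB.mixin Record VE_isTopVE (R : realType) (Z : topOrderedType R) E
    & Tvs R[i] E & VE R Z E := {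
  ve_nbhs0 : forall U : set E, nbhs (0 : E) U <->
    exists (p : Z -> R) (e : R),
      [/\ seminorm p, increasing p, continuous p, 0 < e &
          [set h : E | Num.sqrt (p (gram h h)) < e] `<=` U]
}.

#[short(type="topVEType")]
HB.structure Definition TopVE (R : realType) (Z : topOrderedType R) :=
  {E of Tvs R[i] E & VE R Z E & VE_isTopVE R Z E}.

HB.mixin Record TopVE_isVH (R : realType) (Z : admissibleType R) E
    & TopVE R Z E := {
  vh_complete : tvs_complete E
}.

#[short(type="vhType")]
HB.structure Definition VH (R : realType) (Z : admissibleType R) :=
  {E of TopVE R Z E & TopVE_isVH R Z E}.

(* VH-spaces whose underlying vector space is the subspace [S] of [V]. *)
#[short(type="subVHType")]
HB.structure Definition SubVH (R : realType) (Z : admissibleType R)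
    (V : lmodType R[i]) (S : pred V) :=
  {E of VH R Z E & GRing.SubLmodule R[i] S E}.

Definition linear_span (R : realType) (V : lmodType R[i]) (A : set V) : set V :=
  [set v | exists (n : nat) (a : 'I_n -> R[i]) (u : 'I_n -> V),
    (forall i, A (u i)) /\ v = \sum_(i < n) a i *: u i].

Section Operators.
Variables (R : realType) (Z : admissibleType R) (K : vhType Z).

Definition bounded_op (T : K -> K) : Prop :=
  exists2 C : R, 0 <= C &
    forall e : K, gram (T e) (T e) <=z (C ^+ 2)%:C *: (gram e e : Z).

Definition is_adjoint (T S : K -> K) : Prop :=
  forall e f : K, gram (T e) f = gram e (S f) :> Z.

Definition bounded_adjointable (T : {linear K -> K}) : Prop :=
  bounded_op T /\ exists S : {linear K -> K}, is_adjoint T S.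

End Operators.

HB.mixin Record Semigroup_isStarSemigroup G & Semigroup G := {
  sstar : G -> G ;
  sstarM : forall x y : G, sstar (x * y)%g = (sstar y * sstar x)%g ;
  sstarK : forall x : G, sstar (sstar x) = x
}.

#[short(type="starSemigroupType")]
HB.structure Definition StarSemigroup :=
  {G of Semigroup G & Semigroup_isStarSemigroup G}.

Definition is_semigroup_action (G : semigroupType) (X : Type)
    (act : G -> X -> X) : Prop :=
  forall (a b : G) (x : X), act a (act b x) = act (a * b)%g x.

(* Adjoints are unique, so [is_adjoint (pi g) (pi (sstar g))] says
   that [pi (sstar g)] is the adjoint of [pi g]. *)
Definition star_representation (R : realType) (Z : admissibleType R)
    (G : starSemigroupType) (K : vhType Z) (pi : G -> {linear K -> K}) : Prop :=
  [/\ forall g, bounded_adjointable (pi g),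
      forall g h v, pi (g * h)%g v = pi g (pi h v) &
      forall g, is_adjoint (pi g) (pi (sstar g))].

Section Kernels.
Variables (R : realType) (Z : admissibleType R) (X : Type) (k : X -> X -> Z).

Definition hermitian_kernel : Prop := forall x y, k x y = zstar (k y x).

Definition weakly_psd : Prop :=
  forall (n : nat) (x : 'I_n -> X) (t : 'I_n -> R[i]),
    0 <=z \sum_(j < n) \sum_(l < n) ((t l)^* * t j) *: k (x l) (x j).

Variables (G : starSemigroupType) (act : G -> X -> X).

Definition invariant_kernel : Prop :=
  forall (x y : X) (g : G), k y (act g x) = k (act (sstar g) y) x.

Definition bounded_action : Prop :=
  forall a : G, exists2 c : R, 0 <= c &
    forall (n : nat) (x : 'I_n -> X) (t : 'I_n -> R[i]),
      \sum_(j < n) \sum_(l < n)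
          (t j * (t l)^*) *: k (act a (x l)) (act a (x j))
      <=z (c ^+ 2)%:C *:
          \sum_(j < n) \sum_(l < n) (t j * (t l)^*) *: k (x l) (x j).

Definition invariant_weak_linearisation (K : vhType Z)
    (pi : G -> {linear K -> K}) (V : X -> K) : Prop :=
  [/\ forall x y, k x y = gram (V x) (V y),
      star_representation pi &
      forall g x, V (act g x) = pi g (V x)].

Definition minimal_linearisation (K : vhType Z) (V : X -> K) : Prop :=
  dense (linear_span (range V)).

(* [r x] is the kernel function [k (-, x)] as an element of the
   subspace [S] of [X -> Z] carrying the VH-space [K]. *)
Definition weak_reproducing_kernel_space (S : pred (X -> Z))
    (K : subVHType Z S) (r : X -> K) : Prop :=
  [/\ hermitian_kernel,
      forall x, val (r x) = k^~ x &
      forall (f : K) x, val f x = gram (r x) f].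

Definition kernel_representation (S : pred (X -> Z)) (K : subVHType Z S)
    (r : X -> K) (rho : G -> {linear K -> K}) : Prop :=
  star_representation rho /\ forall g x, rho g (r x) = r (act g x).

Definition minimal_reproducing_kernel_space (S : pred (X -> Z))
    (K : subVHType Z S) (r : X -> K) : Prop :=
  dense (linear_span (range r)).

End Kernels.

(* Main.v *)
Require Import Defs.
From HB Require Import structures.
From mathcomp Require Import all_boot all_order all_algebra.
From mathcomp Require Import all_classical all_reals all_analysis.
From mathcomp Require Import complex ring lra.

(** A reproducing kernel space with a representation is a linearisation, and a
    linearisation gives the three conditions on the kernel by computing with
    gramians.  Everything therefore rests on building, from a kernel with these
    conditions, a topologically minimal reproducing kernel space with its
    representation.

    The span of the functions [k^~ x] carries the inner product determined by
    [k x y] being the gramian of [k^~ x] and [k^~ y].  Instead of completing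
    it abstractly, the completion is located inside [X -> Z].  Every [f : X -> Z]
    acts on formal linear combinations [w] of points by [pair w f], which is what
    the gramian of [comb w] and [f] has to be.  The norm of this functional
    ([dual_le]) makes sense for all [f], is equivalent on the span to the norm
    given by the gramian, and passes to pointwise limits.  The space is the
    closure of the span for these norms ([rkfun]), the gramian extends to it as a
    limit in the complete space [Z] ([is_gram_exists]), the reproducing property
    is true by construction, and completeness ([rk_complete]) is the usual
    argument for spaces of functions: take the pointwise limit, then pass to the
    limit in the Cauchy estimate.

    In a VE-space the Schwarz inequality is used up to a constant, through
    increasing seminorms, and the involution of [Z] need not be continuous.  Both
    difficulties are settled by studying the [Z]-valued quadratic form
    [[x + t y, x + t y]] in [t] ([positive_quadratic]): its positivity survives
    limits and implies the Schwarz inequality as well as Hermitian symmetry.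

    The representation is [f |-> f \o act (sstar g)].  Invariance of the kernel
    makes it map [k^~ x] to [k^~ (act g x)], and boundedness of the action makes
    it bounded on the span, hence on the closure; adjoints are found by
    approximating [f] by formal combinations. *)

Set Implicit Arguments.
Unset Strict Implicit.
Unset Printing Implicit Defensive.

Import Order.TTheory GRing.Theory Num.Theory.
Import numFieldTopology.Exports numFieldNormedType.Exports.

Local Open Scope classical_set_scope.
Local Open Scope complex_scope.
Local Open Scope ring_scope.
Local Notation normc := Normc.normc.

(** * Seminorms and gauges *)

Section ComplexModulus.
Variable R : realType.
Implicit Types (a : R[i]) (r : R).

Lemma normcE a : `|a| = (normc a)%:C.
Proof. by []. Qed.

Lemma normc_ge0 a : 0 <= normc a.
Proof. by case: a => x y; exact: sqrtr_ge0. Qed.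

Lemma normcR r : 0 <= r -> normc r%:C = r.
Proof. by move=> r0; rewrite /= expr0n addr0 sqrtr_sqr ger0_norm. Qed.

Lemma normc_gt0 a : a != 0 -> 0 < normc a.
Proof.
move=> a0; rewrite lt_neqAle normc_ge0 andbT eq_sym.
by apply: contra a0 => /eqP/Normc.eq0_normc ->.
Qed.

End ComplexModulus.

Section Seminorms.
Variables (R : realType) (V : lmodType R[i]).
Implicit Types (p : V -> R) (a : R[i]) (x y z : V).

Lemma seminorm_ge0 p x : seminorm p -> 0 <= p x.
Proof. by case. Qed.

Lemma seminormD p x y : seminorm p -> p (x + y) <= p x + p y.
Proof. by case. Qed.

Lemma seminormZ p a x : seminorm p -> p (a *: x) = normc a * p x.
Proof.
by case=> _ _ hZ; apply: complexI; rewrite hZ normcE rmorphM.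
Qed.

Lemma seminormZR p (r : R) x : 0 <= r -> seminorm p ->
  p (r%:C *: x) = r * p x.
Proof. by move=> r0 hp; rewrite seminormZ// normcR. Qed.

Lemma seminorm0 p : seminorm p -> p 0 = 0.
Proof. by move=> hp; rewrite -(scale0r 0) seminormZ// Normc.normc0 mul0r. Qed.

Lemma seminormN p x : seminorm p -> p (- x) = p x.
Proof.
move=> hp; rewrite -scaleN1r seminormZ//.
suff -> : normc (-1 : R[i]) = 1 by rewrite mul1r.
by rewrite /= oppr0 expr0n addr0 sqrrN expr1n sqrtr1.
Qed.

Lemma seminormBC p x y : seminorm p -> p (x - y) = p (y - x).
Proof. by move=> hp; rewrite -seminormN// opprB. Qed.

Lemma seminormB p x y : seminorm p -> p (x - y) <= p x + p y.
Proof. by move=> hp; rewrite (le_trans (seminormD _ _ hp))// seminormN. Qed.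

Lemma seminorm_trans p x y z : seminorm p -> p (x - z) <= p (x - y) + p (y - z).
Proof. by move=> hp; rewrite -{1}(subrK y x) -addrA seminormD. Qed.

Lemma seminorm_dist p x y : seminorm p -> `|p x - p y| <= p (x - y).
Proof.
move=> hp; rewrite ler_norml; apply/andP; split.
  by rewrite lerNl opprB lerBlDr seminormBC// -{1}(subrK x y) seminormD.
by rewrite lerBlDr -{1}(subrK y x) seminormD.
Qed.

Lemma seminorm_add p q : seminorm p -> seminorm q -> seminorm (p \+ q).
Proof.
move=> hp hq; split=> [x|x y|a x] /=; first by rewrite addr_ge0 ?seminorm_ge0.
  by rewrite addrACA lerD ?seminormD.
by rewrite !seminormZ// -mulrDr rmorphM.
Qed.

End Seminorms.

Section Gauge.
Variables (R : realType) (V : tvsType R[i]) (N : set V).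
Hypotheses (Nnbhs : nbhs (0 : V) N) (Nconv : absolutely_convex N).
Implicit Types (a b : R[i]) (x y : V) (t : R).

Let dilations x : set R := [set t | 0 < t /\ N ((t^-1)%:C *: x)].
(** The Minkowski functional: its open unit ball lies in [N], and it is
    continuous when [N] is a neighbourhood of [0], so that neighbourhoods can
    be traded for seminorms. *)
Definition gauge x : R := inf (dilations x).

Let N_convex a b x y : normc a + normc b <= 1 -> N x -> N y ->
  N (a *: x + b *: y).
Proof.
move=> ab1; apply: Nconv; rewrite !normcE -rmorphD.
by have := lecR (normc a + normc b) 1; rewrite ab1 => ->.
Qed.

Let N_scale a x : normc a <= 1 -> N x -> N (a *: x).
Proof.
move=> a1 Nx; rewrite -[_ *: _]addr0 -(scale0r x).
by apply: N_convex => //; rewrite Normc.normc0 addr0.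
Qed.

Let dilations_neq0 x : dilations x !=set0.
Proof.
have /= := @scale_continuous R[i] V (0, x) N; rewrite scale0r.
move=> /(_ Nnbhs) [[A B] /= [/nbhs_ballP[e/= e0 eA] /nbhs_singleton Bx]] AB.
have e0' : 0 < complex.Re e by move: e0; rewrite ltcE => /andP[].
have eE : e = (complex.Re e)%:C by rewrite RRe_real ?gtr0_real.
exists (2 / complex.Re e); split; first by rewrite divr_gt0.
apply: (AB (_, x)); split => //=; apply: eA.
rewrite -ball_normE /= sub0r normrN normcE normcR ?invr_ge0 ?divr_ge0 ?ltW//.
by rewrite [ltRHS]eE ltcR invf_div ltr_pdivrMr// ltr_pMr// ltr1n.
Qed.

Let dilations_lb x : has_lbound (dilations x).
Proof. by exists 0 => t [/ltW]. Qed.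

Lemma gauge_le x t : 0 < t -> N ((t^-1)%:C *: x) -> gauge x <= t.
Proof. by move=> t0 Nt; apply: ge_inf => //; split. Qed.

Lemma gauge_lt x t : gauge x < t -> 0 < t /\ N ((t^-1)%:C *: x).
Proof.
move=> /inf_lt [//|s [s0 Ns] st].
have t0 := lt_trans s0 st; split => //.
have -> : (t^-1)%:C *: x = (s / t)%:C *: ((s^-1)%:C *: x).
  by rewrite scalerA -rmorphM/= mulrC mulKf ?gt_eqF.
apply: N_scale Ns; rewrite normcR; last by rewrite divr_ge0 ?ltW.
by rewrite ler_pdivrMr// mul1r ltW.
Qed.

Lemma gauge_ball x : gauge x < 1 -> N x.
Proof. by move=> /gauge_lt[_]; rewrite invr1 scale1r. Qed.

Let gauge_ge0 x : 0 <= gauge x.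
Proof. by apply: lb_le_inf => // t [/ltW]. Qed.

Let gaugeD x y : gauge (x + y) <= gauge x + gauge y.
Proof.
apply/ler_addgt0Pr => e e0.
have [s0 Ns] : 0 < gauge x + e / 2 /\ N ((gauge x + e / 2)^-1%:C *: x).
  by apply: gauge_lt; rewrite ltrDl divr_gt0.
have [t0 Nt] : 0 < gauge y + e / 2 /\ N ((gauge y + e / 2)^-1%:C *: y).
  by apply: gauge_lt; rewrite ltrDl divr_gt0.
rewrite (splitr e) addrACA; move: s0 Ns t0 Nt.
set s := gauge x + _; set t := gauge y + _ => s0 Ns t0 Nt.
have st0 : 0 < s + t by exact: addr_gt0.
apply: gauge_le => //.
have -> : ((s + t)^-1)%:C *: (x + y) =
    (s / (s + t))%:C *: (s^-1%:C *: x) + (t / (s + t))%:C *: (t^-1%:C *: y).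
  by rewrite !scalerA -!rmorphM/= mulrAC mulfV ?gt_eqF// mulrAC mulfV ?gt_eqF//
     !mul1r scalerDr.
apply: N_convex => //; rewrite !normcR; do ?by rewrite divr_ge0 ?ltW.
by rewrite -mulrDl mulfV// gt_eqF.
Qed.

Let gaugeZ_le a x : a != 0 -> gauge (a *: x) <= normc a * gauge x.
Proof.
move=> a0; have na0 := normc_gt0 a0.
rewrite -ler_pdivrMl//; apply: lb_le_inf => // t [t0 Nt].
rewrite ler_pdivrMl//; apply: gauge_le; first exact: mulr_gt0.
have -> : ((normc a * t)^-1)%:C *: (a *: x) =
    (a * ((normc a)^-1)%:C) *: (t^-1%:C *: x).
  by rewrite !scalerA invfM rmorphM/=; congr (_ *: _); rewrite mulrC mulrA.
apply: N_scale Nt; rewrite Normc.normcM normcR ?invr_ge0 ?normc_ge0//.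
by rewrite mulfV// gt_eqF.
Qed.

Lemma gauge_seminorm : seminorm gauge.
Proof.
split => // a x; rewrite normcE -rmorphM/=; congr (_%:C).
have [->|a0] := eqVneq a 0.
  rewrite scale0r Normc.normc0 mul0r; apply/le_anti; rewrite gauge_ge0 andbT.
  apply/ler_addgt0Pr => e e0; rewrite add0r; apply: gauge_le => //.
  by rewrite scaler0; exact: nbhs_singleton.
apply/le_anti; rewrite gaugeZ_le//=.
(* The reverse inequality is the first one for [a^-1] and [a *: x]. *)
have := @gaugeZ_le a^-1 (a *: x); rewrite invr_eq0 => /(_ a0).
by rewrite scalerA mulVf// scale1r Normc.normcV ler_pdivlMl// normc_gt0.
Qed.

Lemma nbhs_gauge (e : R) : 0 < e -> nbhs (0 : V) [set x | gauge x < e].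
Proof.
move=> e0; have h : (e / 2)%:C != 0 :> R[i].
  by apply/eqP => /complexI/eqP; rewrite gt_eqF// divr_gt0.
apply: filterS (nbhs0Z h Nnbhs) => _ [x Nx <-] /=.
rewrite (seminormZR _ _ gauge_seminorm) ?divr_ge0 ?ltW//.
have : gauge x <= 1 by apply: gauge_le => //; rewrite invr1 scale1r.
by move=> gx1; rewrite (le_lt_trans (ler_wpM2l _ gx1)) ?divr_ge0 ?ltW// mulr1
  gtr_pMr// invf_lt1// ltr1n.
Qed.

End Gauge.

Lemma seminorm_continuous (R : realType) (V : tvsType R[i]) (p : V -> R) :
  seminorm p -> (forall e, 0 < e -> nbhs (0 : V) [set x | p x < e]) ->
  continuous p.
Proof.
move=> hp p0 x; apply/cvgrPdist_lt => e e0.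
apply: filterS (nbhsT x (p0 _ e0)) => _ [y py <-].
rewrite (le_lt_trans (seminorm_dist _ _ hp))//.
by rewrite opprD addrA subrr add0r seminormN.
Qed.

Lemma continuous_seminorm_ball (R : realType) (V : tvsType R[i]) (p : V -> R)
    (e : R) : seminorm p -> continuous p -> 0 < e ->
  forall x, nbhs x [set y | p (x - y) < e].
Proof.
move=> hp cp e0 x.
have h0 : nbhs (0 : V) [set y | p y < e].
  have /cvgrPdist_lt/(_ _ e0) := cp 0; apply: filterS => y /=.
  rewrite (seminorm0 hp) sub0r normrN; exact/le_lt_trans/ler_norm.
apply: filterS (nbhsT x h0) => _ [y py <-] /=.
by rewrite opprD addrA subrr add0r seminormN.
Qed.

(** * Ordered star-spaces and their increasing seminorms *)

(** Estimates below come with an error [M * e], the constant [M] depending on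
    the seminorm in use; this is what removes the error. *)
Lemma ler_addMgt0 (R : realFieldType) (x y M : R) : 0 <= M ->
  (forall e, 0 < e -> x <= y + M * e) -> x <= y.
Proof.
move=> M0 h; apply/ler_addgt0Pr => e e0; have M1 : 0 < M + 1 by lra.
apply: (le_trans (h (e / (M + 1)) _)); first exact: divr_gt0.
by rewrite lerD2l mulrA ler_pdivrMr// mulrDr mulrC; lra.
Qed.

Section OrderedStar.
Variables (R : realType) (Z : orderedStarType R).
Implicit Types (x y z A b c D : Z) (a t : R[i]).

Lemma zpos0 : zpos (0 : Z).
Proof.
by have [] : (zpos `&` [set z | zpos (- z)]) (0 : Z) by rewrite zpos_strict.
Qed.

Lemma zposD x y : zpos x -> zpos y -> zpos (x + y).
Proof.
move=> hx hy; have := zpos_cone _ _ _ _ (@ler01 R) (@ler01 R) hx hy.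
by rewrite !scale1r.
Qed.

Lemma zposZ (r : R) x : 0 <= r -> zpos x -> zpos (r%:C *: x).
Proof.
move=> r0 hx; have := zpos_cone _ _ _ _ r0 (lexx 0) hx zpos0.
by rewrite scaler0 addr0.
Qed.

Lemma zle0 z : 0 <=z z <-> zpos z.
Proof. by rewrite /zle subr0. Qed.

Lemma zstarD x y : zstar (x + y) = zstar x + zstar y.
Proof. by have := zstar_conjlinear (1 : R[i]) x y; rewrite conjC1 !scale1r. Qed.

Lemma zstar0 : zstar (0 : Z) = 0.
Proof. by apply: zpos_selfadjoint; exact: zpos0. Qed.

Lemma zstarZ a x : zstar (a *: x) = a^* *: zstar x.
Proof. by have := zstar_conjlinear a x 0; rewrite zstar0 !addr0. Qed.

(** If [A], [b], [c], [D] are the four values [x, x], [x, y], [y, x], [y, y] of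
    a gramian, the element below is the gramian of [x + t y] with itself.
    Hermitian symmetry and a Schwarz inequality follow from its
    positivity.  Stated for four elements of [Z], they apply to formal linear
    combinations, which are not taken modulo any relation, and to limits for
    which sesquilinearity is not known yet. *)
Definition positive_quadratic A b c D :=
  forall t, zpos (A + (t * t^*) *: D + (t *: b + t^* *: c)).

Let sqr_realc (s : R) : s%:C * (s%:C)^* = (s ^+ 2)%:C :> R[i].
Proof. by rewrite -[(s%:C)^*]/(conjc s%:C) conjc_real -rmorphM. Qed.

(** The involution of [Z] is not assumed continuous, so Hermitian symmetry
    cannot be carried through a limit; positivity can, and it forces the
    symmetry because positive elements are selfadjoint. *)
Lemma positive_quadratic_star A b c D : zpos A -> zpos D ->
  positive_quadratic A b c D -> c = zstar b.
Proof.
move=> hA hD H.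
have selfadj t : t^* *: zstar b + t *: zstar c = t *: b + t^* *: c.
  have := zpos_selfadjoint _ (H t).
  rewrite !zstarD !zstarZ !conjCK rmorphM/= conjCK.
  rewrite (zpos_selfadjoint _ hA) (zpos_selfadjoint _ hD) [t^* * t]mulrC.
  by move=> /addrI.
(* With [t = 1] the sum [b + c] is selfadjoint, with [t = 'i] the difference
   [b - c] is anti-selfadjoint. *)
have h1 : zstar b + zstar c = b + c.
  by have := selfadj 1; rewrite conjC1 !scale1r.
have h2 : zstar b - zstar c = c - b.
  have := selfadj 'i; rewrite conjCi => /(congr1 ( *:%R 'i)).
  rewrite !scalerDr !scalerA mulrN -expr2 sqrCi opprK !scale1r !scaleN1r.
  by rewrite [- b + c]addrC.
have : zstar b + zstar b = c + c.
  transitivity ((zstar b + zstar c) + (zstar b - zstar c)).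
    by rewrite addrACA subrr addr0.
  by rewrite h1 h2 [b + c]addrC addrACA subrr addr0.
have two : (2 : R[i]) != 0 by rewrite pnatr_eq0.
rewrite -!mulr2n -[zstar b *+ 2]scaler_nat -[c *+ 2]scaler_nat.
by move=> /(scalerI two).
Qed.

(** A Schwarz inequality up to a constant.  Let [G] be the part of the quadratic
    that is odd in [t] and [M] its even part: both [M + G] and [M - G] are
    positive, hence [M + G <= M + M], and an increasing seminorm satisfies
    [p G <= 3 p M].  Taking [t] real and then imaginary isolates [b]. *)
Lemma positive_quadratic_le A b c D (p : Z -> R) : seminorm p -> increasing p ->
  zpos A -> zpos D -> positive_quadratic A b c D ->
  p b <= 6 * Num.sqrt (p A) * Num.sqrt (p D).
Proof.
move=> hp ip hA hD H.
have pG t s : 0 < s -> t * t^* = (s ^+ 2)%:C ->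
    p (t *: b + t^* *: c) <= 3 * (p A + s ^+ 2 * p D).
  move=> s0 ts; have := H t; have := H (- t).
  rewrite rmorphN/= mulrNN ts !scaleNr -opprD.
  set G := _ + _ *: c; set M := A + _ => HM HP.
  have hM : zpos M by apply: zposD => //; apply: zposZ => //; exact: sqr_ge0.
  have pM : p M <= p A + s ^+ 2 * p D.
    by rewrite (le_trans (seminormD _ _ hp))// seminormZR// sqr_ge0.
  have pMG : p (M + G) <= p M + p M.
    apply: (@le_trans _ _ (p (M + M))); last exact: seminormD.
    by apply: ip; rewrite /zle ?subr0// opprD addrACA subrr add0r.
  have : p G <= p (M + G) + p M.
    by rewrite -{1}(addKr M G) addrC seminormB.
  lra.
(* [t = s] and [t = 'i s] bound [s (b + c)] and [s (b - c)]. *)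
have bs s : 0 < s -> s * p b <= 3 * (p A + s ^+ 2 * p D).
  move=> s0; have ss := ltW s0.
  have h1 := pG s%:C s s0 (sqr_realc s).
  have h2 : p (('i * s%:C) *: b + ('i * s%:C)^* *: c) <=
      3 * (p A + s ^+ 2 * p D).
    apply: (pG _ s s0).
    rewrite rmorphM/= conjCi mulrACA sqr_realc mulrN -expr2 sqrCi opprK.
    by rewrite mul1r.
  move: h1 h2; rewrite rmorphM/= conjCi mulNr scaleNr.
  rewrite -[(s%:C)^*]/(conjc s%:C) conjc_real.
  rewrite -scalerBr -scalerDr -scalerA seminormZR// seminormZ// seminormZR//.
  have -> : Normc.normc ('i : R[i]) = 1.
    by apply: complexI; rewrite -normcE normCi.
  rewrite mul1r => h1 h2.
  have : p (b + b) <= p (b + c) + p (b - c).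
    have -> : b + b = (b + c) + (b - c) by rewrite addrACA subrr addr0.
    exact: seminormD.
  rewrite -mulr2n -scaler_nat -(rmorph_nat (real_complex R)) seminormZR//.
  nra.
set u := Num.sqrt (p A); set v := Num.sqrt (p D).
have u0 : 0 <= u by exact: sqrtr_ge0.
have v0 : 0 <= v by exact: sqrtr_ge0.
have pA : p A = u ^+ 2 by rewrite sqr_sqrtr// seminorm_ge0.
have pD : p D = v ^+ 2 by rewrite sqr_sqrtr// seminorm_ge0.
(* The bound is optimal in [s] for [s = u / v]; [e] keeps [s] positive. *)
apply: (@ler_addMgt0 _ _ _ (3 * (u + v))) => [|e e0]; first lra.
have ue : 0 < u + e by lra.
have ve : 0 < v + e by lra.
have := bs ((u + e) / (v + e)) (divr_gt0 ue ve); rewrite pA pD.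
rewrite mulrAC ler_pdivrMr// => h.
have : (u + e) * p b <=
    3 * (u ^+ 2 * (v + e) + (u + e) * ((u + e) / (v + e)) * v ^+ 2).
  apply: (le_trans h); rewrite le_eqVlt; apply/orP; left; apply/eqP.
  by field; lra.
have : (u + e) / (v + e) * v ^+ 2 <= (u + e) * v.
  rewrite mulrAC ler_pdivrMr// expr2 mulrA ler_wpM2l//; last lra.
  by rewrite mulr_ge0// ltW.
have : u ^+ 2 * (v + e) <= (u + e) * (u * (v + e)).
  by have := mulr_ge0 (mulr_ge0 (ltW e0) u0) (ltW ve); lra.
set q := _ / _ => h1 h2 h3.
rewrite -(ler_pM2l ue); apply: (le_trans h3).
have := ler_wpM2l (ltW ue) h2; lra.
Qed.

End OrderedStar.

Section TopOrdered.
Variables (R : realType) (Z : topOrderedType R).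
Implicit Types (p q : Z -> R) (x y z : Z).

Definition increasing_seminorm p := [/\ seminorm p, increasing p & continuous p].

Lemma increasing_seminorm0 : increasing_seminorm (fun=> 0).
Proof.
split=> //; last by move=> z; exact: cvg_cst.
by split=> //; move=> *; rewrite ?addr0 ?mulr0.
Qed.

Lemma increasing_seminorm_add p q : increasing_seminorm p ->
  increasing_seminorm q -> increasing_seminorm (p \+ q).
Proof.
move=> [hp ip cp] [hq iq cq]; split; first exact: seminorm_add.
  by move=> x y x0 xy; rewrite /= lerD ?ip ?iq.
by move=> x; apply: cvgD; [exact: cp|exact: cq].
Qed.

(** The gauge of an absolutely convex solid neighbourhood is increasing, because
    solidity passes to the dilations of the neighbourhood. *)
Lemma nbhs_increasing_seminorm z (B : set Z) : nbhs z B ->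
  exists2 p, increasing_seminorm p & forall y, p (z - y) < 1 -> B y.
Proof.
move=> /(@nbhsB _ Z B z (- z)); rewrite addNr => B0.
have [N [N0 Nc Ns NB]] := z_solid_base _ B0.
have gs := gauge_seminorm N0 Nc.
exists (gauge N); last first.
  move=> y; rewrite seminormBC// => /(gauge_ball N0 Nc)/NB[b Bb].
  by rewrite addrC => /addIr <-.
split => //; last first.
  by apply: seminorm_continuous => // e; exact: nbhs_gauge.
move=> x y x0 xy; apply/ler_addgt0Pr => e e0.
have [t0 Nt] : 0 < gauge N y + e /\ N ((gauge N y + e)^-1%:C *: y).
  by apply: gauge_lt => //; rewrite ltrDl.
apply: gauge_le => //; apply: (Ns _ _ Nt).
  by apply/zle0/zposZ; [rewrite invr_ge0 ltW|exact/zle0].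
by rewrite /zle -scalerBr; apply: zposZ; [rewrite invr_ge0 ltW|].
Qed.

Lemma increasing_seminorm_separated z :
  (forall p, increasing_seminorm p -> p z = 0) -> z = 0.
Proof.
move=> pz; apply: z_hausdorff => A B /nbhs_increasing_seminorm[p hp pA].
move=> /nbhs_singleton B0; exists 0; split => //.
by apply: pA; rewrite subr0 pz.
Qed.

(** Identities in [Z] between limits are proved with this lemma: both sides are
    compared with a common approximation, at a cost proportional to [e]. *)
Lemma increasing_seminorm_small z :
  (forall p, increasing_seminorm p ->
    exists2 M, 0 <= M & forall e, 0 < e -> p z <= M * e) -> z = 0.
Proof.
move=> pz; apply: increasing_seminorm_separated => p hp.
have [M M0 hM] := pz _ hp; have [sp _ _] := hp.
apply/le_anti; rewrite seminorm_ge0// andbT.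
by apply: (ler_addMgt0 M0) => e e0; rewrite add0r hM.
Qed.

(** Closedness of the cone, in the form in which positivity of a limit is
    proved. *)
Lemma zpos_approx z :
  (forall p, increasing_seminorm p ->
    exists2 M, 0 <= M &
      forall e, 0 < e -> exists2 y, zpos y & p (z - y) <= M * e) ->
  zpos z.
Proof.
move=> h; apply: zpos_closed => B /nbhs_increasing_seminorm[p hp pB].
have [M M0 /(_ (M + 1)^-1)[|y hy zy]] := h _ hp.
  by rewrite invr_gt0; lra.
exists y; split => //; apply: pB; rewrite (le_lt_trans zy)//.
by rewrite ltr_pdivrMr; lra.
Qed.

End TopOrdered.

Section Admissible.
Variables (R : realType) (Z : admissibleType R).

Lemma increasing_seminorm_complete (T : Type) (F : set_system T) (u : T -> Z) :
  ProperFilter F ->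
  (forall p e, increasing_seminorm p -> 0 < e ->
    exists2 A, F A & forall x y, A x -> A y -> p (u x - u y) < e) ->
  exists z : Z, forall p e, increasing_seminorm p -> 0 < e ->
    F [set x | p (z - u x) < e].
Proof.
move=> FF cF; have [] := @z_complete R Z (u @ F) (fmap_proper_filter u FF).
  move=> U /nbhs_increasing_seminorm[p hp pU].
  have [A FA Ap] := cF p 1 hp ltr01.
  exists (u @` A).
    by apply: (@filterS _ F _ A) => // x Ax; exists x.
  move=> _ _ [x Ax <-] [y Ay <-]; apply: pU.
  by rewrite sub0r opprB; exact: Ap.
move=> z uz; exists z => p e [sp ip cp] e0.
by apply: (uz [set y | p (z - y) < e]); exact: continuous_seminorm_ball.
Qed.

End Admissible.

(** * The span of the kernel functions and its closure *)

Section FormalCombinations.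
Variables (R : realType) (Z : admissibleType R) (X : Type) (k : X -> X -> Z).

(** A word is a formal linear combination of points of [X].  It stands for the
    vector [comb], the combination of the kernel functions [k^~ x].  The element
    [pair w f], which makes sense for every function [f], is the value that the
    reproducing property imposes on the gramian of [comb w] and [f].  Words
    avoid the question whether [pair w f] depends on [comb w] only. *)
Definition word := seq (R[i] * X).
Implicit Types (w : word) (f g : X -> Z) (a t : R[i]).

Definition comb w : X -> Z := fun y => \sum_(c <- w) c.1 *: k y c.2.
Definition pair w f : Z := \sum_(c <- w) (c.1)^* *: f c.2.
Definition form w w' : Z := pair w (comb w').
Definition scalew t w : word := [seq (t * c.1, c.2) | c <- w].

Lemma comb_cat w w' : comb (w ++ w') = comb w + comb w'.
Proof. by apply/funext => y; rewrite /comb big_cat. Qed.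

Lemma comb_scale t w : comb (scalew t w) = t *: comb w.
Proof.
apply/funext => y; rewrite /comb big_map /= /GRing.scale/= scaler_sumr.
by apply: eq_bigr => c _; rewrite scalerA.
Qed.

Lemma comb_sum n (x : 'I_n -> X) (t : 'I_n -> R[i]) :
  comb [seq (t j, x j) | j <- enum 'I_n] =
  fun y => \sum_(j < n) t j *: k y (x j).
Proof. by apply/funext => y; rewrite /comb big_map big_enum. Qed.

Lemma pair_cat w w' f : pair (w ++ w') f = pair w f + pair w' f.
Proof. by rewrite /pair big_cat. Qed.

Lemma pair_scale t w f : pair (scalew t w) f = t^* *: pair w f.
Proof.
rewrite /pair big_map scaler_sumr; apply: eq_bigr => c _.
by rewrite scalerA rmorphM.
Qed.

Lemma pairD w f g : pair w (f + g) = pair w f + pair w g.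
Proof.
by rewrite /pair -big_split; apply: eq_bigr => c _; rewrite /= -scalerDr.
Qed.

Lemma pairZ w a f : pair w (a *: f) = a *: pair w f.
Proof.
rewrite /pair scaler_sumr; apply: eq_bigr => c _.
by rewrite scalerA mulrC -scalerA.
Qed.

Lemma pairB w f g : pair w (f - g) = pair w f - pair w g.
Proof. by rewrite pairD -scaleN1r pairZ scaleN1r. Qed.

Lemma pair1 x f : pair [:: (1, x)] f = f x.
Proof. by rewrite /pair big_seq1 conjC1 scale1r. Qed.

Lemma comb1 x : comb [:: (1, x)] = k^~ x.
Proof. by apply/funext => y; rewrite /comb big_seq1 scale1r. Qed.

Lemma pair_sum n (x : 'I_n -> X) (t : 'I_n -> R[i]) f :
  pair [seq (t j, x j) | j <- enum 'I_n] f = \sum_(j < n) (t j)^* *: f (x j).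
Proof. by rewrite /pair big_map big_enum. Qed.

Lemma form_sum n (x : 'I_n -> X) (t : 'I_n -> R[i]) :
  form [seq (t j, x j) | j <- enum 'I_n] [seq (t j, x j) | j <- enum 'I_n] =
  \sum_(j < n) \sum_(l < n) ((t l)^* * t j) *: k (x l) (x j).
Proof.
rewrite /form pair_sum comb_sum exchange_big; apply: eq_bigr => l _ /=.
by rewrite scaler_sumr; apply: eq_bigr => j _; rewrite scalerA.
Qed.

Lemma word_enum w : exists n (x : 'I_n -> X) (t : 'I_n -> R[i]),
  w = [seq (t j, x j) | j <- enum 'I_n].
Proof.
exists (size w), (fun j => (tnth (in_tuple w) j).2),
  (fun j => (tnth (in_tuple w) j).1).
transitivity [seq tnth (in_tuple w) j | j <- enum 'I_(size w)].
  by rewrite map_tnth_enum.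
by apply: eq_map => j; case: (tnth (in_tuple w) j).
Qed.

Hypothesis psd : weakly_psd k.

Lemma form_ge0 w : zpos (form w w).
Proof.
have [n [x [t ->]]] := word_enum w; rewrite form_sum.
exact/zle0/psd.
Qed.

(** This is positivity of [form] at the word [w ++ scalew t w']. *)
Lemma form_quadratic w w' :
  positive_quadratic (form w w) (form w w') (form w' w) (form w' w').
Proof.
move=> t; have := form_ge0 (w ++ scalew t w').
rewrite /form comb_cat comb_scale pair_cat pair_scale !pairD !pairZ.
rewrite scalerDr scalerA [t^* * t]mulrC -!addrA; congr zpos; congr (_ + _).
by rewrite [RHS]addrC -addrA.
Qed.

Lemma form_star w w' : form w' w = zstar (form w w').
Proof.
exact: (positive_quadratic_star (form_ge0 w) (form_ge0 w') (form_quadratic w w')).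
Qed.

Lemma psd_hermitian : hermitian_kernel k.
Proof.
move=> x y; have := form_star [:: (1, y)] [:: (1, x)].
by rewrite /form !pair1 !comb1.
Qed.

Definition wnorm (p : Z -> R) w : R := Num.sqrt (p (form w w)).

Lemma wnorm_ge0 p w : 0 <= wnorm p w.
Proof. exact: sqrtr_ge0. Qed.

Lemma form_schwarz p w w' : increasing_seminorm p ->
  p (form w w') <= 6 * wnorm p w * wnorm p w'.
Proof.
move=> [sp ip _].
exact: (positive_quadratic_le sp ip (form_ge0 w) (form_ge0 w') (form_quadratic w w')).
Qed.

Lemma sqr_wnorm p w : increasing_seminorm p -> wnorm p w ^+ 2 = p (form w w).
Proof. by move=> [sp _ _]; rewrite sqr_sqrtr// seminorm_ge0. Qed.

(** The norm of [f] as an antilinear functional on the words, for the seminorm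
    that [p] induces on them.  For an element of the span this norm is
    equivalent to the induced seminorm ([dual_le_comb], [wnorm_le]), but it is
    defined for every [f] and is a closed condition for pointwise convergence.
    Quantifying over all [q] below [p] makes it monotone in [p], which the
    functional norm for [p] alone need not be. *)
Definition dual_le (p : Z -> R) (C : R) f := 0 <= C /\
  forall q, increasing_seminorm q -> (forall z, q z <= p z) ->
    forall w, q (pair w f) <= C * wnorm q w.

Lemma dual_leD p C C' f g : dual_le p C f -> dual_le p C' g ->
  dual_le p (C + C') (f + g).
Proof.
move=> [C0 hf] [C'0 hg]; split; first exact: addr_ge0.
move=> q hq qp w; have [sq _ _] := hq.
rewrite pairD mulrDl (le_trans (seminormD _ _ sq))// lerD//.
  exact: hf.
exact: hg.
Qed.

Lemma dual_leZ p C a f : dual_le p C f -> dual_le p (normc a * C) (a *: f).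
Proof.
move=> [C0 hf]; split; first by rewrite mulr_ge0// normc_ge0.
move=> q hq qp w; have [sq _ _] := hq.
by rewrite pairZ seminormZ// -mulrA ler_wpM2l ?normc_ge0// hf.
Qed.

Lemma dual_leN p C f : dual_le p C f -> dual_le p C (- f).
Proof.
move=> [C0 hf]; split=> // q hq qp w; have [sq _ _] := hq.
by rewrite -scaleN1r pairZ scaleN1r seminormN// hf.
Qed.

Lemma dual_leB p C C' f g : dual_le p C f -> dual_le p C' g ->
  dual_le p (C + C') (f - g).
Proof. by move=> hf hg; apply: dual_leD => //; exact: dual_leN. Qed.

Lemma dual_le_weaken p p' C C' f : (forall z, p' z <= p z) -> C <= C' ->
  dual_le p C f -> dual_le p' C' f.
Proof.
move=> pp CC [C0 hf]; split; first exact: le_trans CC.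
move=> q hq qp w; rewrite (le_trans (hf q hq _ w))//.
  by move=> z; exact: le_trans (pp z).
by rewrite ler_wpM2r// wnorm_ge0.
Qed.

Lemma dual_le0 p : dual_le p 0 0.
Proof.
split=> // q [sq _ _] _ w; rewrite -(scale0r 0) pairZ scale0r seminorm0//.
by rewrite mul0r.
Qed.

Lemma dual_le_self p C f w : increasing_seminorm p -> dual_le p C f ->
  p (pair w f) <= C * wnorm p w.
Proof. by move=> hp [_]; apply. Qed.

Lemma dual_le_comb p w : increasing_seminorm p ->
  dual_le p (6 * wnorm p w) (comb w).
Proof.
move=> hp; split; first by rewrite mulr_ge0 ?wnorm_ge0.
move=> q hq qp w'; rewrite (le_trans (form_schwarz _ _ hq))//.
rewrite mulrAC ler_wpM2r ?wnorm_ge0// ler_wpM2l//.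
by rewrite ler_wsqrtr.
Qed.

(** The value at [w] of the functional given by [comb w] is [form w w], on which
    [p] is the square of [wnorm p w]. *)
Lemma wnorm_le p C w : increasing_seminorm p -> dual_le p C (comb w) ->
  wnorm p w <= C.
Proof.
move=> hp hw; have := dual_le_self w hp hw; rewrite -/(form w w) -sqr_wnorm//.
have := wnorm_ge0 p w; rewrite le_eqVlt => /predU1P[<- _|w0]; first by case: hw.
by rewrite expr2 ler_pM2r.
Qed.

(** The closure of the span of the kernel functions inside [X -> Z]: this is the
    completion of the span, realised by functions from the start. *)
Definition rkfun f := forall p e, increasing_seminorm p -> 0 < e ->
  exists w, dual_le p e (f - comb w).

Lemma rkfun_comb w : rkfun (comb w).
Proof.
move=> p e hp e0; exists w; rewrite subrr.
by apply: dual_le_weaken (dual_le0 p) => //; exact: ltW.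
Qed.

Lemma rkfun0 : rkfun 0.
Proof.
by have := rkfun_comb [::]; congr rkfun; apply/funext => y; rewrite /comb big_nil.
Qed.

Lemma rkfun_linear a f g : rkfun f -> rkfun g -> rkfun (a *: f + g).
Proof.
move=> hf hg p e hp e0.
have a1 : 0 < normc a + 1 by rewrite ltr_wpDl// normc_ge0.
have [w hw] := hf p (e / (normc a + 1) / 2) hp
  (divr_gt0 (divr_gt0 e0 a1) (ltr0Sn _ 1)).
have [w' hw'] := hg p (e / 2) hp (divr_gt0 e0 (ltr0Sn _ 1)).
exists (scalew a w ++ w'); rewrite comb_cat comb_scale opprD addrACA -scalerBr.
apply: dual_le_weaken (dual_leD (dual_leZ a hw) hw') => //.
rewrite [leRHS]splitr lerD2r mulrA ler_pM2r// mulrCA ler_piMr ?ltW//.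
by rewrite ltr_pdivrMr// mul1r ltrDl.
Qed.

Lemma rkfun_bounded f p : rkfun f -> increasing_seminorm p ->
  exists C, dual_le p C f.
Proof.
move=> hf hp; have [w hw] := hf p 1 hp ltr01.
by exists (1 + 6 * wnorm p w); rewrite -[f](subrK (comb w));
  apply: dual_leD => //; exact: dual_le_comb.
Qed.

Lemma wnorm_near p C e f w : increasing_seminorm p -> dual_le p C f ->
  dual_le p e (f - comb w) -> wnorm p w <= C + e.
Proof.
move=> hp hf hw; apply: wnorm_le => //.
by rewrite -[comb w](subKr f); exact: dual_leB.
Qed.

(** The gramian of [f] and [g] is the limit of [pair w g] as the words [w] tend
    to [f]; this is the limit together with its rate. *)
Definition is_gram f g z := forall p C e w, increasing_seminorm p ->
  dual_le p C g -> dual_le p e (f - comb w) -> p (z - pair w g) <= C * e.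

(** The words close to [f] form a filter, along which [pair w g] is Cauchy
    because [g] is a bounded functional; completeness of [Z] gives the limit. *)
Lemma is_gram_exists f g : rkfun f -> rkfun g -> exists z, is_gram f g z.
Proof.
move=> hf hg.
pose F := filter_from
  [set pe : (Z -> R) * R | increasing_seminorm pe.1 /\ 0 < pe.2]
  (fun pe => [set w | dual_le pe.1 pe.2 (f - comb w)]).
have cauchy p C e e' w w' : increasing_seminorm p -> dual_le p C g ->
    dual_le p e (f - comb w) -> dual_le p e' (f - comb w') ->
    p (pair w g - pair w' g) <= C * (e + e').
  move=> hp hC hw hw'.
  have -> : pair w g - pair w' g = pair (w ++ scalew (-1) w') g.
    by rewrite pair_cat pair_scale rmorphN1 scaleN1r.
  rewrite (le_trans (dual_le_self _ hp hC))// ler_wpM2l//; first by case: hC.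
  apply: wnorm_le => //; rewrite comb_cat comb_scale scaleN1r.
  have -> : comb w - comb w' = (f - comb w') - (f - comb w).
    by rewrite opprB [RHS]addrC addrA subrK.
  by rewrite addrC; exact: dual_leB.
have FF : ProperFilter F.
  apply: filter_from_proper; last first.
    by move=> [p e] [/= hp e0]; exact: hf.
  apply: filter_from_filter.
    by exists ((fun=> 0), 1); split=> //=; exact: increasing_seminorm0.
  move=> [p e] [p' e'] [/= hp e0] [/= hp' e'0].
  exists (p \+ p', Num.min e e'); first by split=> /=;
    [exact: increasing_seminorm_add|rewrite lt_min e0].
  have [[sp _ _] [sp' _ _]] := (hp, hp').
  move=> w /= hw; split; apply: dual_le_weaken hw => [z|] /=.
  - by rewrite lerDl seminorm_ge0.
  - by rewrite ge_min lexx.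
  - by rewrite lerDr seminorm_ge0.
  - by rewrite ge_min lexx orbT.
have [] := @increasing_seminorm_complete R Z _ F (fun w => pair w g) FF.
  move=> p e hp e0; have [C hC] := rkfun_bounded hg hp.
  have C0 : 0 <= C by case: hC.
  pose d := e / (2 * (C + 1)).
  have d0 : 0 < d by rewrite divr_gt0// mulr_gt0// ltr_wpDl.
  exists [set w | dual_le p d (f - comb w)]; first by exists (p, d).
  move=> w w' hw hw'; rewrite (le_lt_trans (cauchy _ _ _ _ _ _ hp hC hw hw'))//.
  have -> : e = (C + 1) * (d + d) by rewrite /d; field; lra.
  by rewrite ltr_pM2r ?addr_gt0// ltrDl.
move=> z hz; exists z => p C e w hp hC hw; have [sp _ _] := hp.
have C0 : 0 <= C by case: hC.
apply: (@ler_addMgt0 _ _ _ (1 + C)) => [|d d0]; first by rewrite addr_ge0.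
have [w' [/= zw' hw']] : [set w' | p (z - pair w' g) < d] `&`
    [set w' | dual_le p d (f - comb w')] !=set0.
  by apply: (@filter_ex _ F); apply: filterI; [exact: hz|exists (p, d)].
rewrite (le_trans (seminorm_trans _ (pair w' g) _ sp))//.
have := cauchy _ _ _ _ _ _ hp hC hw' hw; lra.
Qed.

Definition kgram f g : Z := xget 0 (is_gram f g).

Lemma kgramP f g : rkfun f -> rkfun g -> is_gram f g (kgram f g).
Proof. by move=> hf hg; have [z hz] := is_gram_exists hf hg; exact: xgetI hz. Qed.

Lemma kgram_comb w g : rkfun g -> kgram (comb w) g = pair w g.
Proof.
move=> hg; apply/eqP; rewrite -subr_eq0; apply/eqP.
apply: increasing_seminorm_separated => p hp; have [sp _ _] := hp.
have [C hC] := rkfun_bounded hg hp.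
have := kgramP (rkfun_comb w) hg hp hC (w := w) (e := 0).
rewrite subrr mulr0 => /(_ (dual_le0 p)) h.
by apply/le_anti; rewrite h seminorm_ge0.
Qed.

Lemma kgram_linear f a g h : rkfun f -> rkfun g -> rkfun h ->
  kgram f (a *: g + h) = a *: kgram f g + kgram f h.
Proof.
move=> hf hg hh; apply/eqP; rewrite -subr_eq0; apply/eqP.
have hgh := rkfun_linear a hg hh.
apply: increasing_seminorm_small => p hp; have [sp _ _] := hp.
have [C hC] := rkfun_bounded hg hp; have [C' hC'] := rkfun_bounded hh hp.
have [D hD] := rkfun_bounded hgh hp.
exists (D + (normc a * C + C')).
  by rewrite !addr_ge0 ?mulr_ge0 ?normc_ge0//; [case: hD|case: hC|case: hC'].
move=> e e0; have [w hw] := hf p e hp e0.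
rewrite (le_trans (seminorm_trans _ (pair w (a *: g + h)) _ sp))// mulrDl lerD//.
  exact: (kgramP hf hgh).
rewrite pairD pairZ opprD addrACA -scalerBr (le_trans (seminormD _ _ sp))//.
rewrite mulrDl lerD//.
  by rewrite seminormZ// -mulrA ler_wpM2l ?normc_ge0// seminormBC// (kgramP hf hg).
by rewrite seminormBC// (kgramP hf hh).
Qed.

(** The gramian is also the joint limit of [form w w'], which carries positivity
    over from words to functions. *)
Lemma kgram_form p C e f g w w' : increasing_seminorm p -> rkfun f -> rkfun g ->
  dual_le p C f -> dual_le p C g -> e <= 1 ->
  dual_le p e (f - comb w) -> dual_le p e (g - comb w') ->
  p (kgram f g - form w w') <= (2 * C + 1) * e.
Proof.
move=> hp hf hg hCf hCg e1 hw hw'; have [sp _ _] := hp.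
have e0 : 0 <= e by case: hw.
rewrite (le_trans (seminorm_trans _ (pair w g) _ sp))//.
have h1 := kgramP hf hg hp hCg hw.
have := dual_le_self w hp hw'; rewrite pairB => h2.
have := ler_wpM2l e0 (wnorm_near hp hCf hw).
have := ler_wpM2l e0 e1.
rewrite /form; lra.
Qed.

(** The minimum with [1] keeps the errors in the range of [kgram_form]. *)
Lemma common_approx p f g : increasing_seminorm p -> rkfun f -> rkfun g ->
  exists C, [/\ 0 <= C, dual_le p C f, dual_le p C g & forall e, 0 < e ->
    exists w w', [/\ dual_le p (Num.min e 1) (f - comb w) &
                     dual_le p (Num.min e 1) (g - comb w')]].
Proof.
move=> hp hf hg; have [C hC] := rkfun_bounded hf hp.
have [C' hC'] := rkfun_bounded hg hp.
have [C0 C'0] : 0 <= C /\ 0 <= C' by split; [case: hC|case: hC'].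
exists (C + C'); split.
- exact: addr_ge0.
- by apply: dual_le_weaken hC => //; rewrite lerDl.
- by apply: dual_le_weaken hC' => //; rewrite lerDr.
move=> e e0; have m0 : 0 < Num.min e 1 by rewrite lt_min e0 ltr01.
have [w hw] := hf p _ hp m0; have [w' hw'] := hg p _ hp m0.
by exists w, w'.
Qed.

Lemma kgram_ge0 f : rkfun f -> zpos (kgram f f).
Proof.
move=> hf; apply: zpos_approx => p hp.
have [C [C0 hC _ ap]] := common_approx hp hf hf.
exists (2 * C + 1); first lra.
move=> e e0; have [w [_ [hw _]]] := ap e e0.
exists (form w w); first exact: form_ge0.
rewrite (le_trans (kgram_form hp hf hf hC hC _ hw hw)) ?ge_min ?lexx ?orbT//.
by rewrite ler_wpM2l ?ge_min ?lexx//; lra.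
Qed.

Lemma kgram_quadratic f g : rkfun f -> rkfun g ->
  positive_quadratic (kgram f f) (kgram f g) (kgram g f) (kgram g g).
Proof.
move=> hf hg t; apply: zpos_approx => p hp; have [sp _ _] := hp.
have [C [C0 hCf hCg ap]] := common_approx hp hf hg.
pose M := (2 * C + 1) * (1 + normc (t * t^*) + (normc t + normc t^*)).
have n0 := @normc_ge0 R.
exists M; first by rewrite mulr_ge0//; [lra|rewrite !addr_ge0].
move=> e e0; have [w [w' [hw hw']]] := ap e e0.
exists (form w w + (t * t^*) *: form w' w' + (t *: form w w' + t^* *: form w' w)).
  exact: form_quadratic.
have close (f' g' : X -> Z) v v' : rkfun f' -> rkfun g' -> dual_le p C f' ->
    dual_le p C g' -> dual_le p (Num.min e 1) (f' - comb v) ->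
    dual_le p (Num.min e 1) (g' - comb v') ->
    p (kgram f' g' - form v v') <= (2 * C + 1) * e.
  move=> h1 h2 h3 h4 h5 h6.
  rewrite (le_trans (kgram_form hp h1 h2 h3 h4 _ h5 h6)) ?ge_min ?lexx ?orbT//.
  by rewrite ler_wpM2l ?ge_min ?lexx//; lra.
rewrite !opprD addrACA [X in X + _]addrACA [X in _ + X]addrACA -!scalerBr.
rewrite (le_trans (seminormD _ _ sp))// /M mulrAC mulrDr lerD//.
  rewrite (le_trans (seminormD _ _ sp))// mulrDr mulr1 lerD ?close//.
  by rewrite seminormZ// mulrC ler_wpM2r ?close.
rewrite (le_trans (seminormD _ _ sp))// mulrDr !seminormZ//.
by rewrite lerD// mulrC ler_wpM2r ?close.
Qed.

Lemma kgram_star f g : rkfun f -> rkfun g -> kgram f g = zstar (kgram g f).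
Proof.
move=> hf hg.
exact: (positive_quadratic_star (kgram_ge0 hg) (kgram_ge0 hf) (kgram_quadratic hg hf)).
Qed.

(** With [norm_le_dual], this says that the functional norm and the norm given by
    the gramian are equivalent on the completion. *)
Lemma dual_le_norm p f : increasing_seminorm p -> rkfun f ->
  dual_le p (6 * Num.sqrt (p (kgram f f))) f.
Proof.
move=> hp hf; split; first by rewrite mulr_ge0 ?sqrtr_ge0.
move=> q hq qp w; have [sq iq _] := hq.
have hw := rkfun_comb w; rewrite -kgram_comb//.
rewrite (le_trans (positive_quadratic_le sq iq (kgram_ge0 hw) (kgram_ge0 hf)
  (kgram_quadratic hw hf)))//.
rewrite kgram_comb// mulrAC ler_wpM2r ?wnorm_ge0// ler_wpM2l//.
by rewrite ler_wsqrtr.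
Qed.

(** For [w] close to [f] the gramian of [f] is close to [pair w f], which is at
    most [C * wnorm p w], and [wnorm p w] is at most [C] up to a small error. *)
Lemma norm_le_dual p C f : increasing_seminorm p -> rkfun f ->
  dual_le p C f -> Num.sqrt (p (kgram f f)) <= C.
Proof.
move=> hp hf hC; have [sp _ _] := hp; have C0 : 0 <= C by case: hC.
rewrite -(ger0_norm C0) -sqrtr_sqr ler_wsqrtr//.
apply: (@ler_addMgt0 _ _ _ (2 * C)) => [|e e0]; first lra.
have [w hw] := hf p e hp e0.
have h1 := kgramP hf hf hp hC hw.
have h2 := dual_le_self w hp hC.
have h3 := ler_wpM2l C0 (wnorm_near hp hC hw).
have := seminormD (kgram f f - pair w f) (pair w f) sp; rewrite subrK.
rewrite expr2; lra.
Qed.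

(** A function of norm zero vanishes pointwise, since evaluation at [x] is the
    pairing with a one-letter word. *)
Lemma kgram_eq0 f : rkfun f -> kgram f f = 0 -> f = 0.
Proof.
move=> hf f0; apply/funext => x.
apply: increasing_seminorm_separated => p hp; have [sp _ _] := hp.
have := dual_le_self [:: (1, x)] hp (dual_le_norm hp hf).
rewrite f0 seminorm0// sqrtr0 mulr0 mul0r pair1 => h.
by apply/le_anti; rewrite h seminorm_ge0.
Qed.

End FormalCombinations.

(** * The topology of a family of seminorms *)

HB.factory Record Lmodule_hasSeminorms (R : realType) E
    & GRing.Lmodule R[i] E := {
  seminorms : set (E -> R) ;
  seminorms_seminorm : forall p, seminorms p -> seminorm p ;
  seminorms_neq0 : seminorms !=set0 ;
  seminorms_directed : forall p q, seminorms p -> seminorms q ->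
    exists2 r, seminorms r & forall x, p x <= r x /\ q x <= r x
}.

HB.builders Context (R : realType) E & Lmodule_hasSeminorms R E.

Definition ball_of (p : E -> R) (x : E) (e : R) : set E :=
  [set y | p (x - y) < e].

Definition nbhs_of (x : E) : set_system E := [set A |
  exists p e, [/\ seminorms p, 0 < e & ball_of p x e `<=` A]].

HB.instance Definition _ := hasNbhs.Build E nbhs_of.

Let ball_center p x e : seminorms p -> 0 < e -> ball_of p x e x.
Proof.
by move=> /seminorms_seminorm sp e0; rewrite /ball_of/= subrr seminorm0.
Qed.

Let nbhs_singleton (x : E) (A : set E) : nbhs x A -> A x.
Proof. by move=> [p [e [hp e0]]]; apply; exact: ball_center. Qed.

Let nbhs_filter (x : E) : ProperFilter (nbhs x).
Proof.
apply: Build_ProperFilter_ex => [A /nbhs_singleton|]; first by exists x.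
split.
- by have [p hp] := seminorms_neq0; exists p, 1.
- move=> A B [p [e [hp e0 pA]]] [q [d [hq d0 qB]]].
  have [r hr pqr] := seminorms_directed hp hq.
  exists r, (Num.min e d); split => //; first by rewrite lt_min e0.
  move=> y; rewrite /ball_of/= lt_min => /andP[re rd]; have [pr qr] := pqr (x - y).
  by split; [apply: pA; exact: le_lt_trans re|apply: qB; exact: le_lt_trans rd].
- move=> A B AB [p [e [hp e0 pA]]]; exists p, e; split => //.
  exact: subset_trans AB.
Qed.

Let nbhs_ball p x y e : seminorms p -> ball_of p x e y -> nbhs y (ball_of p x e).
Proof.
move=> hp xy; have sp := seminorms_seminorm hp.
exists p, (e - p (x - y)); split=> //; first by rewrite subr_gt0.
move=> z; rewrite /ball_of/= ltrBrDl => yz.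
exact: le_lt_trans (seminorm_trans _ _ _ sp) yz.
Qed.

Let nbhs_nbhs (x : E) (A : set E) : nbhs x A -> nbhs x (nbhs^~ A).
Proof.
move=> [p [e [hp e0 pA]]]; exists p, e; split=> // y xy.
exact: (@filterS _ (nbhs y) (nbhs_filter y)) pA (nbhs_ball hp xy).
Qed.

HB.instance Definition _ :=
  Nbhs_isNbhsTopological.Build E nbhs_filter nbhs_singleton nbhs_nbhs.

Let add_continuous : continuous (fun x : E * E => x.1 + x.2).
Proof.
move=> [x y] A /= [p [e [hp e0 pA]]]; have sp := seminorms_seminorm hp.
exists (ball_of p x (e / 2), ball_of p y (e / 2)).
  by split; apply: nbhs_ball => //; apply: ball_center => //; rewrite divr_gt0.
move=> [x' y'] [/= hx hy]; apply: pA; rewrite /ball_of/= opprD addrACA.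
by rewrite (le_lt_trans (seminormD _ _ sp))// [e]splitr ltrD.
Qed.

Let scale_continuous : continuous (fun z : R[i]^o * E => z.1 *: z.2).
Proof.
move=> [a x] A /= [p [e [hp e0 pA]]]; have sp := seminorms_seminorm hp.
have px0 : 0 <= p x by exact: seminorm_ge0.
pose d := Num.min 1 (e / 2 / (p x + 1)).
pose d' := e / 2 / (normc a + 1).
have na := normc_ge0 a.
have d0 : 0 < d by rewrite lt_min ltr01 !divr_gt0//; lra.
have d'0 : 0 < d' by rewrite !divr_gt0//; lra.
exists ([set b | normc (a - b) < d], ball_of p x d').
  split; last by apply: nbhs_ball => //; exact: ball_center.
  apply/nbhs_ballP; exists d%:C; first by rewrite /= ltcR.
  by move=> b; rewrite -ball_normE /= normcE ltcR.
move=> [b y] [/= ab xy]; apply: pA; rewrite /ball_of/=.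
have -> : a *: x - b *: y = (a - b) *: x + b *: (x - y).
  by rewrite scalerBl scalerBr addrA subrK.
rewrite (le_lt_trans (seminormD _ _ sp))// !seminormZ// [e]splitr.
have nb : normc b <= normc a + 1.
  have := lerB_dist b a; rewrite distrC !normcE -rmorphB lecR.
  move: ab; rewrite lt_min => /andP[]; lra.
apply: ler_ltD.
  apply: (@le_trans _ _ (e / 2 / (p x + 1) * p x)).
    by rewrite ler_wpM2r//; move: ab; rewrite lt_min => /andP[_ /ltW].
  rewrite mulrAC ler_pdivrMr; last lra.
  by rewrite ler_wpM2l//; lra.
apply: (@le_lt_trans _ _ ((normc a + 1) * p (x - y))).
  by rewrite ler_wpM2r// seminorm_ge0.
by rewrite mulrC -ltr_pdivlMr//; lra.
Qed.

Let locally_convex :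
  exists2 B : set_system E, (forall b, b \in B -> convex_set b) & basis B.
Proof.
exists [set b | exists p x e, seminorms p /\ b = ball_of p x e].
  move=> b; rewrite inE => -[p [x [e [hp ->]]]] y z l; rewrite !inE => xy xz.
  have sp := seminorms_seminorm hp.
  have -> : conv l y z = l%:inum *: (y : E) + (1 - l%:inum) *: (z : E) by [].
  have [l0 l1] : 0 <= l%:inum /\ l%:inum <= 1 by [].
  set a := l%:inum in l0 l1 *; pose r := complex.Re a.
  have aE : a = r%:C by rewrite RRe_real// ger0_real.
  have [r0 r1] : 0 <= r /\ r <= 1.
    by split; [move: l0|move: l1]; rewrite aE lecE => /andP[].
  rewrite aE -[1]/(1%:C) -rmorphB.
  rewrite /ball_of/=.
  have -> : x - (r%:C *: (y : E) + (1 - r)%:C *: (z : E)) =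
      r%:C *: (x - y) + (1 - r)%:C *: (x - z).
    by rewrite !scalerBr addrACA -scalerDl -rmorphD/= subrKC scale1r opprD.
  rewrite (le_lt_trans (seminormD _ _ sp))// !seminormZR ?subr_ge0//.
  set m := Num.max (p (x - y)) (p (x - z)).
  have me : m < e by rewrite gt_max; apply/andP.
  apply: (le_lt_trans _ me); have -> : m = r * m + (1 - r) * m by ring.
  by rewrite lerD// ler_wpM2l ?subr_ge0// le_max lexx ?orbT.
split.
  move=> _ [p [x [e [hp ->]]]]; rewrite openE => y xy; exact: nbhs_ball.
move=> x A [p [e [hp e0 pA]]]; exists (ball_of p x e) => //.
by split; [exists p, x, e|exact: ball_center].
Qed.

HB.instance Definition _ := PreTopologicalLmod_isTvs.Build R[i] E
  add_continuous scale_continuous locally_convex.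
HB.instance Definition _ :=
  PreTopologicalNmodule_isTopologicalNmodule.Build E add_continuous.
HB.instance Definition _ :=
  TopologicalNmodule_isTopologicalLmodule.Build R[i] E scale_continuous.
HB.instance Definition _ := Uniform_isTvs.Build R[i] E locally_convex.

HB.end.

(** * VE-spaces and the reproducing kernel space *)

Section VESpace.
Variables (R : realType) (Z : orderedStarType R) (E : veType Z).
Implicit Types (x y z : E) (a : R[i]).
Local Notation "[[ x , y ]]" := (gram x y : Z) (at level 0, format "[[ x ,  y ]]").

Lemma gramDr x y z : [[x, y + z]] = [[x, y]] + [[x, z]].
Proof. by rewrite -{1}[y]scale1r gram_linear scale1r. Qed.

Lemma gram0r x : [[x, 0]] = 0.
Proof. by apply: (addrI [[x, 0]]); rewrite -gramDr !addr0. Qed.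

Lemma gramZr x a y : [[x, a *: y]] = a *: [[x, y]].
Proof. by rewrite -[a *: y]addr0 gram_linear gram0r addr0. Qed.

Lemma gramDl x y z : [[x + y, z]] = [[x, z]] + [[y, z]].
Proof. by rewrite gram_herm gramDr zstarD -!gram_herm. Qed.

Lemma gramZl x a y : [[a *: x, y]] = a^* *: [[x, y]].
Proof. by rewrite gram_herm gramZr zstarZ -gram_herm. Qed.

Lemma gram_suml (I : Type) (r : seq I) (F : I -> E) y :
  [[\sum_(i <- r) F i, y]] = \sum_(i <- r) [[F i, y]].
Proof.
elim/big_rec2: _ => [|i u v _ <-]; last by rewrite gramDl.
by rewrite gram_herm gram0r zstar0.
Qed.

Lemma gram_sumr (I : Type) (r : seq I) (F : I -> E) x :
  [[x, \sum_(i <- r) F i]] = \sum_(i <- r) [[x, F i]].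
Proof. by elim/big_rec2: _ => [|i u v _ <-]; rewrite ?gram0r ?gramDr. Qed.

Lemma gram_combination n (v : 'I_n -> E) (t : 'I_n -> R[i]) :
  [[\sum_(l < n) t l *: v l, \sum_(j < n) t j *: v j]] =
  \sum_(j < n) \sum_(l < n) ((t l)^* * t j) *: [[v l, v j]].
Proof.
rewrite gram_sumr; apply: eq_bigr => j _.
rewrite gram_suml; apply: eq_bigr => l _.
by rewrite gramZl gramZr scalerA.
Qed.

Lemma gram_pos x : zpos [[x, x]].
Proof. exact/zle0/gram_ge0. Qed.

(** The triangle inequality holds without the constant of the Schwarz
    inequality: for real [a] and [b], the identity
    [ab [x + y, x + y] + [bx - ay, bx - ay]
      = b (a + b) [x, x] + a (a + b) [y, y]]
    bounds the gramian of [x + y], and it remains to let [a] and [b] decrease to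
    the norms of [x] and [y]. *)
Lemma seminorm_gram (p : Z -> R) : seminorm p -> increasing p ->
  seminorm (fun x : E => Num.sqrt (p [[x, x]])).
Proof.
move=> sp ip; split=> [x|x y|a x]; first exact: sqrtr_ge0.
- set u := Num.sqrt (p [[x, x]]); set v := Num.sqrt (p [[y, y]]).
  have u0 : 0 <= u by exact: sqrtr_ge0.
  have v0 : 0 <= v by exact: sqrtr_ge0.
  have pu : p [[x, x]] = u ^+ 2 by rewrite sqr_sqrtr// seminorm_ge0.
  have pv : p [[y, y]] = v ^+ 2 by rewrite sqr_sqrtr// seminorm_ge0.
  apply: (@ler_addMgt0 _ _ _ 2) => // e e0.
  set a := u + e; set b := v + e.
  have a0 : 0 < a by rewrite /a; lra.
  have b0 : 0 < b by rewrite /b; lra.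
  have ab0 : 0 < a * b by exact: mulr_gt0.
  have -> : u + v + 2 * e = a + b by rewrite /a /b; ring.
  have ab1 : 0 <= a + b by lra.
  rewrite -(ger0_norm ab1) -sqrtr_sqr ler_wsqrtr// -(ler_pM2l ab0).
  rewrite -(seminormZR _ (ltW ab0) sp).
  have le1 : (a * b)%:C *: [[x + y, x + y]] <=z
      (b * (a + b))%:C *: [[x, x]] + (a * (a + b))%:C *: [[y, y]].
    have := gram_pos (b%:C *: x - a%:C *: y); congr zpos.
    rewrite -scaleNr !(gramDr, gramDl, gramZr, gramZl) !scalerDr !scalerA.
    rewrite !opprD -!scaleNr [RHS]addrACA [X in _ = X + _]addrA -scalerDl.
    rewrite [X in _ = _ + X]addrCA -scalerDl.
    have cR (r : R) : (r%:C)^* = r%:C :> R[i] by exact: conjc_real.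
    by rewrite !rmorphN/= !cR; congr (_ *: _ + _ *: _ + (_ *: _ + _ *: _)); ring.
  apply: (le_trans (ip _ _ _ le1)).
    by apply/zle0/zposZ; [exact: ltW|exact: gram_pos].
  apply: (le_trans (seminormD _ _ sp)).
  rewrite !seminormZR ?mulr_ge0 ?(ltW a0) ?(ltW b0)// pu pv.
  have ua : u ^+ 2 <= a ^+ 2 by rewrite ler_sqr ?nnegrE /a; lra.
  have vb : v ^+ 2 <= b ^+ 2 by rewrite ler_sqr ?nnegrE /b; lra.
  have := ler_wpM2l (mulr_ge0 (ltW b0) ab1) ua.
  have := ler_wpM2l (mulr_ge0 (ltW a0) ab1) vb.
  lra.
rewrite normcE -rmorphM/=; congr (_%:C); rewrite gramZl gramZr scalerA.
have -> : a^* * a = (normc a ^+ 2)%:C.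
  by rewrite rmorphXn/= -normcE sqr_normc mulrC.
rewrite seminormZR ?sqr_ge0// sqrtrM ?sqr_ge0// sqrtr_sqr.
by rewrite ger0_norm// normc_ge0.
Qed.

End VESpace.

Section ReproducingSpace.
Variables (R : realType) (Z : admissibleType R) (X : Type) (k : X -> X -> Z).

Definition rkpred : pred (X -> Z) := fun f => `[< rkfun k f >].

Lemma rkpredP f : reflect (rkfun k f) (f \in rkpred).
Proof. exact: asboolP. Qed.

Lemma rkpred_submod : GRing.subsemimod_closed rkpred.
Proof.
split; first split.
- by apply/rkpredP; exact: rkfun0.
- move=> f g /rkpredP hf /rkpredP hg; apply/rkpredP.
  by have := rkfun_linear 1 hf hg; rewrite scale1r.
- move=> a f /rkpredP hf; apply/rkpredP.
  by have := rkfun_linear a hf (rkfun0 k); rewrite addr0.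
Qed.

HB.instance Definition _ :=
  GRing.isSubmodClosed.Build R[i] (X -> Z) rkpred rkpred_submod.

(** The proof of positivity is a parameter of the type because the gramian
    carried by the type is an inner product only under that hypothesis. *)
Record rkspace (psd : weakly_psd k) := RKSpace {
  rkval : X -> Z ; _ : rkval \in rkpred }.

Variable psd : weakly_psd k.
Local Notation H := (rkspace psd).

HB.instance Definition _ := [isSub of H for @rkval psd].
HB.instance Definition _ := [Choice of H by <:].
HB.instance Definition _ := [SubChoice_isSubLmodule of H by <:].

Implicit Types f g h : H.

Lemma rkfun_val f : rkfun k (val f).
Proof. exact/rkpredP/(valP f). Qed.

Definition rkgram f g : Z := kgram k (val f) (val g).

Let rkgram_ge0 f : 0 <=z rkgram f f.
Proof. by apply/zle0/kgram_ge0 => //; exact: rkfun_val. Qed.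

Let rkgram_eq0 f : rkgram f f = 0 <-> f = 0.
Proof.
split=> [/(kgram_eq0 psd (rkfun_val f)) f0|->]; first by apply: val_inj.
rewrite /rkgram -{1}(_ : comb k [::] = val (0 : H)).
  by rewrite kgram_comb//; [rewrite /pair big_nil|exact: rkfun_val].
by apply/funext => y; rewrite /comb big_nil.
Qed.

Let rkgram_herm f g : rkgram f g = zstar (rkgram g f).
Proof. by apply: kgram_star => //; exact: rkfun_val. Qed.

Let rkgram_linear f a g h :
  rkgram f (a *: g + h) = a *: rkgram f g + rkgram f h.
Proof. by apply: kgram_linear => //; exact: rkfun_val. Qed.

HB.instance Definition _ := Lmodule_isVE.Build R Z H
  rkgram_ge0 rkgram_eq0 rkgram_herm rkgram_linear.

Definition rknorm (p : Z -> R) f : R := Num.sqrt (p (gram f f)).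

Lemma rknorm_seminorm p : increasing_seminorm p -> seminorm (rknorm p).
Proof. by move=> [sp ip _]; exact: seminorm_gram. Qed.

Definition rknorms : set (H -> R) :=
  [set n | exists2 p, increasing_seminorm p & n = rknorm p].

Let rknorms_seminorm n : rknorms n -> seminorm n.
Proof. by move=> [p hp ->]; exact: rknorm_seminorm. Qed.

Let rknorms_neq0 : rknorms !=set0.
Proof.
by exists (rknorm (fun=> 0)), (fun=> 0) => //; exact: increasing_seminorm0.
Qed.

Let rknorms_directed n m : rknorms n -> rknorms m ->
  exists2 r, rknorms r & forall x, n x <= r x /\ m x <= r x.
Proof.
move=> [p hp ->] [q hq ->]; have [[sp _ _] [sq _ _]] := (hp, hq).
exists (rknorm (p \+ q)).
  by exists (p \+ q) => //; exact: increasing_seminorm_add.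
by move=> f; split; apply: ler_wsqrtr; rewrite /= ?lerDl ?lerDr seminorm_ge0.
Qed.

HB.instance Definition _ := Lmodule_hasSeminorms.Build R H
  rknorms_seminorm rknorms_neq0 rknorms_directed.

Lemma nbhs_rkspace f (A : set H) : nbhs f A <-> exists p e,
  [/\ increasing_seminorm p, 0 < e & [set g | rknorm p (f - g) < e] `<=` A].
Proof.
split=> [[n [e [[p hp ->] e0 pA]]]|[p [e [hp e0 pA]]]]; first by exists p, e.
by exists (rknorm p), e; split => //; exists p.
Qed.

Let rk_nbhs0 (U : set H) : nbhs (0 : H) U <->
  exists (p : Z -> R) (e : R), [/\ seminorm p, increasing p, continuous p, 0 < e &
    [set h : H | Num.sqrt (p (gram h h)) < e] `<=` U].
Proof.
have sym p f : increasing_seminorm p -> rknorm p (0 - f) = rknorm p f.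
  by move=> hp; rewrite sub0r seminormN//; exact: rknorm_seminorm.
split=> [/nbhs_rkspace[p [e [hp e0 pU]]]|[p [e [sp ip cp e0 pU]]]].
  exists p, e; have [sp ip cp] := hp; split => // f fe.
  by apply: pU; rewrite /= sym.
by apply/nbhs_rkspace; exists p, e; split => // f; rewrite /= sym//; exact: pU.
Qed.

HB.instance Definition _ := VE_isTopVE.Build R Z H rk_nbhs0.

Definition rkword (w : word R X) : H :=
  RKSpace psd (introT (rkpredP _) (rkfun_comb k w)).

Definition rkkernel x : H := rkword [:: (1, x)].

Lemma rkkernelE x : val (rkkernel x) = k^~ x.
Proof. exact: comb1. Qed.

Lemma gram_rkword w f : gram (rkword w) f = pair w (val f) :> Z.
Proof. by apply: kgram_comb => //; exact: rkfun_val. Qed.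

Lemma gram_rkkernel x f : gram (rkkernel x) f = val f x :> Z.
Proof. by rewrite gram_rkword pair1. Qed.

Lemma dual_le_rknorm p f : increasing_seminorm p ->
  dual_le k p (6 * rknorm p f) (val f).
Proof. by move=> hp; apply: dual_le_norm => //; exact: rkfun_val. Qed.

Lemma rknorm_le p C f : increasing_seminorm p ->
  dual_le k p C (val f) -> rknorm p f <= C.
Proof. by move=> hp; apply: norm_le_dual => //; exact: rkfun_val. Qed.

Lemma rkword_near (O : set H) f : nbhs f O -> exists w, O (rkword w).
Proof.
move=> /nbhs_rkspace[p [e [hp e0 pO]]].
have [w hw] := rkfun_val f hp (divr_gt0 e0 (ltr0Sn _ 1)).
exists w; apply: pO => /=; apply: le_lt_trans (_ : e / 2 < e); last lra.
exact: rknorm_le.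
Qed.

(** A Cauchy filter converges pointwise, as evaluations are bounded functionals.
    The pointwise limit inherits the Cauchy estimate since [dual_le] is stable
    under pointwise limits; it is therefore the limit for the norms, and it lies
    in the closure of the span. *)
Let rk_complete : tvs_complete H.
Proof.
move=> F FF cF.
have cauchy p e : increasing_seminorm p -> 0 < e ->
    exists2 A, F A & forall f g, A f -> A g -> rknorm p (f - g) < e.
  move=> hp e0; have sp := rknorm_seminorm hp.
  have [|A FA Ae] := cF [set f | rknorm p f < e].
    apply/nbhs_rkspace; exists p, e; split => // f.
    by rewrite /= sub0r seminormN.
  by exists A => // f g Af Ag; exact: Ae.
have pointwise x : exists z : Z, forall p e, increasing_seminorm p -> 0 < e ->
    F [set f | p (z - val f x) < e].
  apply: increasing_seminorm_complete => p e hp e0.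
  have sp := rknorm_seminorm hp; have [sp' _ _] := hp.
  pose K := 6 * wnorm k p [:: (1, x)].
  have K0 : 0 <= K by rewrite mulr_ge0// wnorm_ge0.
  have [A FA Ae] := cauchy p (e / (K + 1)) hp (divr_gt0 e0 (ltr_wpDl K0 ltr01)).
  exists A => // f g Af Ag.
  have -> : val f x - val g x = pair [:: (1, x)] (val (f - g)).
    by rewrite pair1.
  rewrite (le_lt_trans (dual_le_self _ hp (dual_le_rknorm (f - g) hp)))//.
  have := ler_wpM2l K0 (ltW (Ae _ _ Af Ag)).
  rewrite mulrAC -/K => h; apply: (le_lt_trans h).
  by rewrite mulrCA gtr_pMr// ltr_pdivrMr; lra.
have [f0 hf0] := boolp.choice pointwise.
(* Pointwise convergence, extended to the finite sums [pair w]. *)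
have pairlim w q e : increasing_seminorm q -> 0 < e ->
    F [set g | q (pair w (f0 - val g)) < e].
  move=> hq; have [sq _ _] := hq; elim: w e => [|[a x] w IH] e e0.
    by apply: filterE => g /=; rewrite /pair big_nil seminorm0.
  have n0 : 0 < normc a^* + 1 by rewrite ltr_wpDl// normc_ge0.
  have h1 := hf0 x q (e / 2 / (normc a^* + 1)) hq
    (divr_gt0 (divr_gt0 e0 (ltr0Sn _ 1)) n0).
  have h2 := IH (e / 2) (divr_gt0 e0 (ltr0Sn _ 1)).
  apply: filterS (filterI h1 h2) => g /= [g1 g2].
  rewrite /pair big_cons (le_lt_trans (seminormD _ _ sq))// [e]splitr.
  rewrite ler_ltD// seminormZ//.
  rewrite -[leRHS](divfK (lt0r_neq0 n0)) mulrC.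
  apply: ler_pM; rewrite ?normc_ge0 ?(seminorm_ge0 _ sq) ?lerDl//=.
  exact: ltW.
have close p A e g : increasing_seminorm p -> F A -> A g -> 0 < e ->
    (forall f h, A f -> A h -> rknorm p (f - h) < e) ->
    dual_le k p (6 * e) (f0 - val g).
  move=> hp FA Ag e0 Ae; split; first lra.
  move=> q hq qp w; have [sq _ _] := hq.
  apply: (@ler_addMgt0 _ _ _ 1) => // d d0; rewrite mul1r.
  have [h [/= Ah hh]] := filter_ex (filterI FA (pairlim w q d hq d0)).
  have -> : f0 - val g = (f0 - val h) + val (h - g).
    by rewrite raddfB/= addrA subrK.
  rewrite pairD (le_trans (seminormD _ _ sq))// addrC lerD//; last exact: ltW.
  have [_ /(_ _ hq (fun=> lexx _) w)] := dual_le_rknorm (h - g) hq.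
  move=> /le_trans; apply; rewrite ler_wpM2r ?wnorm_ge0// ler_wpM2l//.
  apply: le_trans (ltW (Ae _ _ Ah Ag)); exact: ler_wsqrtr.
(* The factor 6 of [close] turns [e / 12] into [e / 2], the other half being
   spent on approximating [g] by a word. *)
have rf0 : f0 \in rkpred.
  apply/rkpredP => p e hp e0; have e12 : 0 < e / 12 by rewrite divr_gt0.
  have [A FA Ae] := cauchy p _ hp e12.
  have [g Ag] := filter_ex FA.
  have [w hw] := rkfun_val g hp (divr_gt0 e0 (ltr0Sn _ 1)).
  exists w; rewrite -[f0](subrK (val g)) -addrA.
  apply: dual_le_weaken (dual_leD (close p A _ g hp FA Ag e12 Ae) hw) => //.
  lra.
exists (RKSpace psd rf0) => U /nbhs_rkspace[p [e [hp e0 pU]]].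
have e12 : 0 < e / 12 by rewrite divr_gt0.
have [A FA Ae] := cauchy p _ hp e12.
apply: (filterS _ FA) => g Ag; apply: pU => /=.
apply: le_lt_trans (_ : 6 * (e / 12) < e); last lra.
by apply: rknorm_le => //; rewrite raddfB/=; exact: (close p A _ g hp FA Ag e12 Ae).
Qed.

HB.instance Definition _ := TopVE_isVH.Build R Z H rk_complete.

End ReproducingSpace.

(** * From a linearisation to the kernel *)

Section Linearisation.
Variables (R : realType) (Z : admissibleType R) (X : Type) (k : X -> X -> Z).
Variables (G : starSemigroupType) (act : G -> X -> X).

(** The sums over the kernel are gramians of combinations of the vectors [V x]. *)
Lemma linearisation_kernel (K : vhType Z) (pi : G -> {linear K -> K})
    (V : X -> K) : invariant_weak_linearisation k act pi V ->
  [/\ weakly_psd k, invariant_kernel k act & bounded_action k act].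
Proof.
move=> [kV [bpi _ api] Vact]; split.
- move=> n x t; under eq_bigr do under eq_bigr do rewrite kV.
  by rewrite -(gram_combination (fun j => V (x j)) t); exact: gram_ge0.
- move=> x y g; rewrite !kV !Vact; have := api (sstar g) (V y) (V x).
  by rewrite sstarK.
- move=> a; have [[C C0 hC] _] := bpi a; exists C => // n x t.
  under eq_bigr do under eq_bigr do rewrite mulrC kV !Vact.
  under [in X in _ <=z X]eq_bigr do under eq_bigr do rewrite mulrC kV.
  rewrite -(gram_combination (fun j => pi a (V (x j))) t).
  rewrite -(gram_combination (fun j => V (x j)) t).
  have -> : \sum_(j < n) t j *: pi a (V (x j)) = pi a (\sum_(j < n) t j *: V (x j)).
    by rewrite linear_sum; apply: eq_bigr => j _; rewrite linearZ.
  exact: hC.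
Qed.

End Linearisation.

(** * The action on the reproducing kernel space *)

Section Translation.
Variables (R : realType) (Z : admissibleType R) (X : Type) (k : X -> X -> Z).
Variables (G : starSemigroupType) (act : G -> X -> X).
Hypothesis hact : is_semigroup_action act.
Hypotheses (psd : weakly_psd k) (inv : invariant_kernel k act)
  (bdd : bounded_action k act).
Local Notation H := (rkspace psd).
Implicit Types (w : word R X) (g : G) (f h : H).

Definition actw g w : word R X := [seq (c.1, act g c.2) | c <- w].

Lemma pair_act g w (f : X -> Z) : pair w (f \o act g) = pair (actw g w) f.
Proof. by rewrite /pair big_map. Qed.

Lemma comb_act g w : comb k (actw g w) = comb k w \o act (sstar g).
Proof.
by apply/funext => y; rewrite /comb big_map; apply: eq_bigr => c _ /=; rewrite inv.
Qed.

Lemma form_act g : exists2 c : R, 0 <= c & forall w,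
  form k (actw g w) (actw g w) <=z (c ^+ 2)%:C *: form k w w.
Proof.
have [c c0 hc] := bdd g; exists c => // w.
have [n [x [t ->]]] := word_enum w.
have -> : actw g [seq (t j, x j) | j <- enum 'I_n] =
    [seq (t j, act g (x j)) | j <- enum 'I_n] by rewrite /actw -map_comp.
rewrite (form_sum k (fun j => act g (x j))) form_sum.
have := hc n x t; congr (_ <=z _ *: _);
  by apply: eq_bigr => j _; apply: eq_bigr => l _; rewrite mulrC.
Qed.

Lemma wnorm_act g : exists2 c : R, 0 <= c & forall q w, increasing_seminorm q ->
  wnorm k q (actw g w) <= c * wnorm k q w.
Proof.
have [c c0 hc] := form_act g; exists c => // q w [sq iq _].
have -> : c * wnorm k q w = Num.sqrt (q ((c ^+ 2)%:C *: form k w w)).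
  by rewrite seminormZR ?sqr_ge0// sqrtrM ?sqr_ge0// sqrtr_sqr ger0_norm.
rewrite ler_wsqrtr//; apply: iq (hc w); apply/zle0; exact: form_ge0.
Qed.

(** Boundedness of the action enters here: translating a functional by [sstar g]
    multiplies its norm by at most the constant attached to [sstar g]. *)
Lemma dual_le_act g : exists2 c : R, 0 <= c & forall p C (f : X -> Z),
  dual_le k p C f -> dual_le k p (C * c) (f \o act (sstar g)).
Proof.
have [c c0 hc] := wnorm_act (sstar g); exists c => // p C f [C0 hf].
split=> [|q hq qp w]; first exact: mulr_ge0.
by rewrite pair_act (le_trans (hf q hq qp _))// -mulrA ler_wpM2l// hc.
Qed.

Lemma rkfun_act g (f : X -> Z) : rkfun k f -> rkfun k (f \o act (sstar g)).
Proof.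
move=> hf p e hp e0; have [c c0 hc] := dual_le_act g.
have [|w hw] := hf p (e / (c + 1)) hp.
  by rewrite divr_gt0//; lra.
exists (actw g w); rewrite comb_act.
apply: dual_le_weaken (hc _ _ _ hw) => //.
by rewrite mulrAC ler_pdivrMr; [rewrite ler_wpM2l ?ltW//; lra|lra].
Qed.

(** The reproducing property forces this formula: the value at [x] of the image of
    [f] is the gramian of [k^~ x] and that image, hence of [k^~ (act (sstar g) x)]
    and [f].  Multiplicativity and linearity are then immediate. *)
Definition rkact g f : H :=
  RKSpace psd (introT (rkpredP k _) (rkfun_act g (rkfun_val f))).

Lemma rkact_linear g : linear (rkact g).
Proof. by move=> a f h; apply: val_inj. Qed.

HB.instance Definition _ g :=
  GRing.isLinear.Build R[i] H H *:%R (rkact g) (rkact_linear g).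

Lemma rkactM g g' f : rkact (g * g')%g f = rkact g (rkact g' f).
Proof.
by apply/val_inj/funext => x; rewrite /= sstarM hact.
Qed.

Lemma rkact_kernel g x : rkact g (rkkernel psd x) = rkkernel psd (act g x).
Proof.
apply/val_inj/funext => y; rewrite rkkernelE.
by rewrite -[LHS]/(val (rkkernel psd x) (act (sstar g) y)) rkkernelE inv.
Qed.

(** On a word [w] close to [f], both sides become the pairing of the translated
    word [actw g w] with [h]. *)
Lemma rkact_adjoint g : is_adjoint (rkact g) (rkact (sstar g)).
Proof.
move=> f h; apply/eqP; rewrite -subr_eq0; apply/eqP.
apply: increasing_seminorm_small => p hp; have [sp _ _] := hp.
have [c c0 hc] := dual_le_act g.
have [C hC] := rkfun_bounded psd (rkfun_val h) hp.
have [D hD] := rkfun_bounded psd (rkfun_val (rkact (sstar g) h)) hp.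
have [C0 D0] : 0 <= C /\ 0 <= D by split; [case: hC|case: hD].
exists (C * c + D); first by rewrite addr_ge0 ?mulr_ge0.
move=> e e0; have [w hw] := rkfun_val f hp e0.
have h1 := kgramP psd (rkfun_val f) (rkfun_val _) hp hD hw.
have hgw : dual_le k p (e * c) (val (rkact g f) - comb k (actw g w)).
  by rewrite comb_act; exact: (hc _ _ _ hw).
have h2 := kgramP psd (rkfun_val _) (rkfun_val h) hp hC hgw.
have pw : pair w (val (rkact (sstar g) h)) = pair (actw g w) (val h).
  by rewrite pair_act sstarK.
rewrite (le_trans (seminorm_trans _ (pair (actw g w) (val h)) _ sp))//.
rewrite mulrDl lerD//; first by rewrite -mulrA [c * e]mulrC.
by rewrite seminormBC// -pw.
Qed.

Lemma rkact_bounded g : bounded_op (rkact g).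
Proof.
have [c c0 hc] := form_act g; have [d d0 hd] := dual_le_act g.
exists c => // f; apply: zpos_approx => p hp; have [sp _ _] := hp.
have [C hC] := rkfun_bounded psd (rkfun_val f) hp.
have [D hD] := rkfun_bounded psd (rkfun_val (rkact g f)) hp.
have [C0 D0] : 0 <= C /\ 0 <= D by split; [case: hC|case: hD].
have c20 := sqr_ge0 c.
exists (c ^+ 2 * (2 * C + 1) + (2 * D + 1)).
  by rewrite addr_ge0 ?mulr_ge0//; lra.
(* Dividing by [d + 1] keeps both [e'] and [e' * d], the distances from the
   words to [f] and to its image, below [1] and below [e]. *)
move=> e e0; pose e' := Num.min e 1 / (d + 1).
have m0 : 0 < Num.min e 1 by rewrite lt_min e0 ltr01.
have d1 : 0 < d + 1 by lra.
have e'0 : 0 < e' by rewrite divr_gt0.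
have [me m1] : Num.min e 1 <= e /\ Num.min e 1 <= 1.
  by split; rewrite ge_min lexx ?orbT.
have em : e' * (d + 1) = Num.min e 1 by rewrite /e' divfK// gt_eqF.
have e'd : 0 <= e' * d by rewrite mulr_ge0// ltW.
have [w hw] := rkfun_val f hp e'0.
have hgw : dual_le k p (e' * d) (val (rkact g f) - comb k (actw g w)).
  by rewrite comb_act; exact: (hd _ _ _ hw).
have rf := rkfun_val f; have rgf := rkfun_val (rkact g f).
have e'1 : e' <= 1 by lra.
have e'd1 : e' * d <= 1 by lra.
have h1 := kgram_form psd hp rf rf hC hC e'1 hw hw.
have h2 := kgram_form psd hp rgf rgf hD hD e'd1 hgw hgw.
exists ((c ^+ 2)%:C *: form k w w - form k (actw g w) (actw g w)); first exact: hc.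
rewrite opprD addrACA -scalerBr -opprD (le_trans (seminormB _ _ sp))// mulrDl.
rewrite seminormZR// lerD//.
  rewrite -[leRHS]mulrA; apply: ler_wpM2l => //; apply: (le_trans h1).
  by apply: ler_wpM2l; lra.
by apply: (le_trans h2); apply: ler_wpM2l; lra.
Qed.

Lemma rkact_star_representation : star_representation (fun g => rkact g).
Proof.
split=> [g|g h f|g]; last exact: rkact_adjoint.
  split; first exact: rkact_bounded.
  by exists (rkact (sstar g)); exact: rkact_adjoint.
exact: rkactM.
Qed.

Lemma rkspace_reproducing : weak_reproducing_kernel_space k (rkkernel psd).
Proof.
split=> [|x|f x]; [exact: psd_hermitian|exact: rkkernelE|].
by rewrite gram_rkkernel.
Qed.

(** Density is built in: every element of the space is a limit of words. *)
Lemma rkspace_minimal : minimal_reproducing_kernel_space (rkkernel psd).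
Proof.
move=> O [f Of] oO; have [w Ow] := rkword_near (open_nbhs_nbhs (conj oO Of)).
exists (rkword psd w); split => //.
have [n [x [t ew]]] := word_enum w.
exists n, t, (fun j => rkkernel psd (x j)); split=> [j|]; first by exists (x j).
apply/val_inj/funext => y; rewrite linear_sum fct_sumE/= ew comb_sum.
by apply: eq_bigr => j _; rewrite comb1.
Qed.

End Translation.

Theorem theorem4p5 (R : realType) (Z : admissibleType R)
    (G : starSemigroupType) (X : Type) (act : G -> X -> X)
    (hX : inhabited X) (hact : is_semigroup_action act) (k : X -> X -> Z) :
  let assertion1 :=
    [/\ weakly_psd k, invariant_kernel k act & bounded_action k act] in
  let assertion2 :=
    exists (K : vhType Z) (pi : G -> {linear K -> K}) (V : X -> K),
      invariant_weak_linearisation k act pi V in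
  let assertion3 :=
    exists (S : pred (X -> Z)) (K : subVHType Z S) (r : X -> K),
      weak_reproducing_kernel_space k r /\
      exists rho : G -> {linear K -> K}, kernel_representation act r rho in
  [/\ assertion1 <-> assertion2,
      assertion2 <-> assertion3 &
      [\/ assertion1, assertion2 | assertion3] ->
        (exists (K : vhType Z) (pi : G -> {linear K -> K}) (V : X -> K),
           invariant_weak_linearisation k act pi V /\
           minimal_linearisation V) /\
        (exists (S : pred (X -> Z)) (K : subVHType Z S) (r : X -> K),
           [/\ weak_reproducing_kernel_space k r,
               exists rho : G -> {linear K -> K},
                 kernel_representation act r rho &
               minimal_reproducing_kernel_space r])].
Proof.
move=> assertion1 assertion2 assertion3.
have h21 : assertion2 -> assertion1.
  by move=> [K [pi [V]]]; exact: linearisation_kernel.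
have linearise (S : pred (X -> Z)) (K : subVHType Z S) (r : X -> K)
    (rho : G -> {linear K -> K}) : weak_reproducing_kernel_space k r ->
    kernel_representation act r rho ->
    invariant_weak_linearisation k act rho r.
  move=> [_ rk rf] [srho hrho].
  by split=> [x y||g x]; [rewrite -rf rk|exact: srho|rewrite hrho].
have h1m : assertion1 ->
  exists (S : pred (X -> Z)) (K : subVHType Z S) (r : X -> K),
    [/\ weak_reproducing_kernel_space k r,
        exists rho : G -> {linear K -> K}, kernel_representation act r rho &
        minimal_reproducing_kernel_space r].
  move=> [psd inv bdd]; exists (rkpred k), (rkspace psd), (rkkernel psd); split.
  - exact: rkspace_reproducing.
  - exists (fun g => rkact inv bdd g : {linear rkspace psd -> rkspace psd}).
    split.
      exact: rkact_star_representation.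
    exact: rkact_kernel.
  - exact: rkspace_minimal.
have h32 : assertion3 -> assertion2.
  move=> [S [K [r [hr [rho hrho]]]]]; exists K, rho, r; exact: linearise.
have h13 : assertion1 -> assertion3.
  by move=> /h1m[S [K [r [hr hrho _]]]]; exists S, K, r.
split.
- by split=> [/h13/h32|/h21].
- by split=> [/h21/h13|/h32].
move=> h; have {h}/h1m : assertion1 by case: h => [|/h21|/h32/h21].
move=> [S [K [r [hr [rho hrho] hm]]]]; split.
  by exists K, rho, r; split => //; exact: linearise.
by exists S, K, r; split => //; exists rho.
Qed.
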